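(* Let $G,s\in\mathbb N$ with $s\ge 2$, let $\varepsilon\in(0,\tfrac12)$ and let the true parameter satisfy $\theta_0\in[\varepsilon,1-\varepsilon]$. Let $(X_i,T_i)'$, $i=1,\dots,n$, $n\in\mathbb N$, be i.i.d. random vectors such that, for each $i$, $X_i$ is geometric with $\tilde P_{\theta_0}(X_i=x)=\theta_0(1-\theta_0)^{x-1}$, $x\in\mathbb N$, $T_i$ takes values in $\{0,1,\dots,G-1\}$, and $X_i$ is independent of $T_i$. Let $$\hat\theta_n:=\frac{\sum_{x=1}^{s+G-1}\Delta\,{}_TN^c_\cdot(x)}{\sum_{x=1}^{s+G-1}{}_TY^c_\cdot(x-1)}$$ be the maximum conditional likelihood estimator and $${}^{PB}\sigma^2:=\frac{1}{\theta_0(1-\theta_0)}\sum_{x=1}^{s+G-1}\mathrm E_{\theta_0}\{{}_TY_1^c(x-1)\},\qquad {}^{PB}\sigma:=\sqrt{{}^{PB}\sigma^2}.$$ Then $$\sqrt n\,(\hat\theta_n-\theta_0)\ \Rightarrow\ {}^{PB}\sigma^{-1}Z\qquad(n\to\infty),$$ where $Z\sim N(0,1)$ and $\Rightarrow$ denotes convergence in distribution.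
   Context: $\mathbb N=\{1,2,\dots\}$, $a\wedge b=\min(a,b)$, and $\Delta Z(x):=Z(x)-Z(x-1)$ for a process $Z$ indexed by $\mathbb N_0$. The vector $(X_i,T_i)$ is observed only if $X_i\ge T_i+1$ (left truncation), and observation stops after $s$ years (right censoring); the sample size $n$ is that of the latent sample, including unobserved units. $\mathrm E_{\theta_0}$ is expectation under the (unconditional) law $\tilde P_{\theta_0}$. For each unit $i$ and $x\in\mathbb N_0$ define ${}_TN_i^c(x):=\mathbf 1_{\{T_i<X_i\le x\wedge(T_i+s)\}}$ and ${}_TY_i^c(x):=\mathbf 1_{\{T_i\le x\}}\mathbf 1_{\{x+1\le T_i+s\}}\mathbf 1_{\{X_i\ge x+1\}}$. Put ${}_TN^c_\cdot(x):=\sum_{i=1}^n{}_TN_i^c(x)$ and ${}_TY^c_\cdot(x):=\sum_{i=1}^n{}_TY_i^c(x)$. On the event that the denominator of $\hat\theta_n$ is zero (no unit is observed), $\hat\theta_n$ is set to $0$ by convention. *)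

(* Defs.v *)
From HB Require Import structures.
From mathcomp Require Import all_boot all_order all_algebra finmap.
From mathcomp Require Import all_classical all_reals all_analysis.
From mathcomp Require Import measurable_realfun.

Set Implicit Arguments.
Unset Strict Implicit.
Unset Printing Implicit Defensive.

Import Order.TTheory GRing.Theory Num.Theory.
Import numFieldNormedType.Exports.

Local Open Scope classical_set_scope.
Local Open Scope ring_scope.

Section probability_notions.
Context {d d1 d2 : measure_display} {Omega : measurableType d}
  {U : measurableType d1} {V : measurableType d2} {R : realType}.
Variable P : probability Omega R.

Definition independent_RV2 (X : {RV P >-> U}) (Y : {RV P >-> V}) : Prop :=
  forall (A : set U) (B : set V), measurable A -> measurable B ->
    P ((X @^-1` A) `&` (Y @^-1` B)) = (P (X @^-1` A) * P (Y @^-1` B))%E.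

Definition mutually_independent_RV (I : choiceType) (X : I -> {RV P >-> U}) :
    Prop :=
  forall (J : {fset I}) (A : I -> set U), (forall i, measurable (A i)) ->
    P (\bigcap_(i in [set` J]) (X i @^-1` A i)) =
    (\prod_(i <- J) P (X i @^-1` A i))%E.

Definition identically_distributed (I : Type) (X : I -> {RV P >-> U}) : Prop :=
  forall (i j : I) (A : set U), measurable A ->
    distribution P (X i) A = distribution P (X j) A.

Definition iid (I : choiceType) (X : I -> {RV P >-> U}) : Prop :=
  mutually_independent_RV X /\ identically_distributed X.

Definition pair_fun (X : {RV P >-> U}) (Y : {RV P >-> V}) : Omega -> U * V :=
  fun w => (X w, Y w).

Lemma measurable_pair_fun (X : {RV P >-> U}) (Y : {RV P >-> V}) :
  measurable_fun [set: Omega] (pair_fun X Y).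
Proof. by apply: measurable_fun_pair; exact: measurable_funPT. Qed.

HB.instance Definition _ (X : {RV P >-> U}) (Y : {RV P >-> V}) :=
  isMeasurableFun.Build _ _ _ _ (pair_fun X Y) (measurable_pair_fun X Y).

Definition pair_RV (X : {RV P >-> U}) (Y : {RV P >-> V}) :
  {RV P >-> (U * V)%type} := pair_fun X Y.

End probability_notions.

(* Convergence of the distribution functions at the continuity points of the
   limit; Z may live on another probability space than the Y n. *)
Definition cvg_in_distribution {d d' : measure_display}
    {Omega : measurableType d} {Omega' : measurableType d'} {R : realType}
    (P : probability Omega R) (Q : probability Omega' R)
    (Y : nat -> {RV P >-> R}) (Z : {RV Q >-> R}) : Prop :=
  forall x : R, {for x, continuous (cdf Z)} ->
    cdf (Y n) x @[n --> \oo] --> cdf Z x.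
Arguments cvg_in_distribution {d d' Omega Omega' R} P Q Y Z.

(* Only meaningful for 1 <= x. *)
Definition increment {Omega : Type} {R : pzRingType} (Z : nat -> Omega -> R)
    (x : nat) : Omega -> R :=
  Z x \- Z x.-1.

Lemma measurable_invr (R : realType) :
  measurable_fun [set: R] (fun y : R => y^-1).
Proof.
have -> : [set: R] = [set~ 0] `|` [set 0].
  by rewrite setUC setUv.
apply/measurable_funU; [exact: measurableC|by []|split].
  apply: open_continuous_measurable_fun.
    by apply: closed_openC; exact: closed_eq.
  by move=> x; rewrite inE /= => /eqP; exact: inv_continuous.
exact: measurable_fun_set1.
Qed.

Section truncated_censored_sample.
Context {d : measure_display} {Omega : measurableType d} {R : realType}.
Variable P : probability Omega R.
Variable s : nat.

(* X is the lifetime, T the truncation time of one unit and s the number of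
   observed years: TNc is the truncated and censored counting process, TYc the
   corresponding at-risk process. *)
Definition TNc (X T : {RV P >-> nat}) (x : nat) : Omega -> R :=
  \1_[set w | (T w < X w <= minn x (T w + s))%N].

Definition TYc (X T : {RV P >-> nat}) (x : nat) : Omega -> R :=
  \1_[set w | (T w <= x)%N] \* \1_[set w | (x.+1 <= T w + s)%N] \*
  \1_[set w | (x.+1 <= X w)%N].

(* The units 1, ..., n of the sample are numbered 0, ..., n.-1. *)
Definition TNc_sum (X T : nat -> {RV P >-> nat}) (n x : nat) : Omega -> R :=
  fun w => \sum_(i < n) TNc (X i) (T i) x w.

Definition TYc_sum (X T : nat -> {RV P >-> nat}) (n x : nat) : Omega -> R :=
  fun w => \sum_(i < n) TYc (X i) (T i) x w.

Variable G : nat.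

(* Division by 0 yields 0, which is the required value when no unit is
   observed. *)
Definition theta_hat_fun (X T : nat -> {RV P >-> nat}) (n : nat) : Omega -> R :=
  fun w => (\sum_(1 <= x < s + G) increment (TNc_sum X T n) x w) /
           (\sum_(1 <= x < s + G) TYc_sum X T n x.-1 w).

Lemma measurable_nat_rel (p : nat -> nat -> bool) (X T : {RV P >-> nat}) :
  measurable [set w | p (X w) (T w)].
Proof.
rewrite (_ : [set w | _] = \bigcup_t
    ((X @^-1` [set x | p x t]) `&` (T @^-1` [set t]))); last first.
  apply/seteqP; split=> [w pw|w [t _ [/= pw tw]]] /=; last by rewrite tw.
  by exists (T w).
by apply: bigcup_measurable => t _; apply: measurableI;
  exact: measurable_funPTI.
Qed.

Lemma measurable_TNc (X T : {RV P >-> nat}) (x : nat) :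
  measurable_fun [set: Omega] (TNc X T x).
Proof.
apply: measurable_indic.
exact: (measurable_nat_rel (fun a t => (t < a <= minn x (t + s))%N)).
Qed.

Lemma measurable_TYc (X T : {RV P >-> nat}) (x : nat) :
  measurable_fun [set: Omega] (TYc X T x).
Proof.
apply: measurable_funM; [apply: measurable_funM|]; apply: measurable_indic.
- exact: (measurable_nat_rel (fun _ t => (t <= x)%N) X T).
- exact: (measurable_nat_rel (fun _ t => (x.+1 <= t + s)%N) X T).
- exact: (measurable_nat_rel (fun a _ => (x.+1 <= a)%N) X T).
Qed.

Lemma measurable_theta_hat_fun (X T : nat -> {RV P >-> nat}) (n : nat) :
  measurable_fun [set: Omega] (theta_hat_fun X T n).
Proof.
apply: measurable_funM.
  apply: measurable_sum => x; apply: measurable_funB;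
    by apply: measurable_sum => i; exact: measurable_TNc.
apply: (measurableT_comp (f := fun y : R => y^-1)); first exact: measurable_invr.
by apply: measurable_sum => x; apply: measurable_sum => i; exact: measurable_TYc.
Qed.

HB.instance Definition _ (X T : nat -> {RV P >-> nat}) (n : nat) :=
  isMeasurableFun.Build _ _ _ _ (theta_hat_fun X T n)
    (measurable_theta_hat_fun X T n).

Definition theta_hat (X T : nat -> {RV P >-> nat}) (n : nat) : {RV P >-> R} :=
  theta_hat_fun X T n.

(* The expectation is that of unit 1, numbered 0; fine is harmless as TYc is
   bounded. *)
Definition PB_sigma2 (theta0 : R) (X T : nat -> {RV P >-> nat}) : R :=
  (theta0 * (1 - theta0))^-1 *
  \sum_(1 <= x < s + G) fine 'E_P[TYc (X 0%N) (T 0%N) x.-1].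

Definition PB_sigma (theta0 : R) (X T : nat -> {RV P >-> nat}) : R :=
  Num.sqrt (PB_sigma2 theta0 X T).

End truncated_censored_sample.

(* Main.v *)
Require Import Defs.
From mathcomp Require Import all_boot all_order all_algebra finmap.
From mathcomp Require Import all_classical all_reals all_analysis.
From mathcomp Require Import measurable_realfun.
From mathcomp Require Import ring lra zify.

Set Implicit Arguments.
Unset Strict Implicit.
Unset Printing Implicit Defensive.

Import Order.TTheory GRing.Theory Num.Theory.
Import numFieldNormedType.Exports.

Local Open Scope classical_set_scope.
Local Open Scope ring_scope.

(** With q = 1 - theta0, the estimator depends on unit i only through its
    observed age min(X_i - T_i, s + 1), which is 0 for a truncated unit and
    s + 1 for a censored one.  Given T_i < X_i the age X_i - T_i is again
    geometric, so W_i = N_i - theta0 Y_i (event indicator minus theta0 times the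
    exposure) is centred with variance theta0 q A, where A is the mean exposure.
    As soon as one unit is observed, sqrt n (theta_hat - theta0) <= x is
    equivalent to
      sum_i (W_i - x (Y_i - A) / sqrt n) / sqrt n <= x A,
    a centred triangular array, so that no separate Slutsky argument is needed.
    The central limit theorem for such arrays is Lindeberg's: Gaussian smoothing
    is a semigroup commuting with translations, so replacing the summands one
    by one costs n times a one-step error, which Taylor's formula bounds for
    the logistic functions approximating the indicator of a half-line. *)

(** * Taylor's formula and the logistic function *)

Section taylor.
Variable R : realType.
Implicit Types (f df r : R -> R) (x h M : R).

(** By the mean value theorem [r t] equals [dr c * t] with [c] between 0 and [t], which raises the
    order of the bound by one. The factor 1/(k+1) that integration would give is dropped, since only
    orders in h matter. *)
Lemma le_normr_is_derive (r dr : R -> R) (M h : R) (k : nat) :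
  r 0 = 0 -> (forall t : R, is_derive t 1 r (dr t)) ->
  (forall t, `|t| <= `|h| -> `|dr t| <= M * `|t| ^+ k) ->
  forall t, `|t| <= `|h| -> `|r t| <= M * `|t| ^+ k.+1.
Proof.
move=> r0 dr_ bdr t th.
have cr (a b : R) : {within `[a, b], continuous r}.
  apply: continuous_subspaceT => u; apply: differentiable_continuous.
  exact/derivable1_diffP.
have M0 (u : R) : `|u| <= `|h| -> 0 <= M * `|u| ^+ k.
  by move=> uh; apply: (le_trans _ (bdr _ uh)).
suff [c ct ->] : exists2 c : R, `|c| <= `|t| & r t = dr c * t.
  rewrite normrM exprSr mulrA ler_wpM2r//.
  have ch := le_trans ct th.
  apply: (le_trans (bdr _ ch)).
  (* The sign of [M] is read off the bound at [c], which is possible only when [c] is nonzero. *)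
  have [c0|c0] := eqVneq `|c| 0.
    case: k {bdr} M0 => [|k] M0; first by rewrite !expr0.
    by rewrite c0 expr0n/= mulr0; exact: M0.
  have Mge0 : 0 <= M.
    by have := M0 _ ch; rewrite pmulr_lge0// exprn_gt0// lt0r c0 normr_ge0.
  by rewrite ler_wpM2l// lerXn2r ?nnegrE.
have [t0|t0] := leP 0 t.
  have [c /[!in_itv]/=/andP[c0 ct]] := MVT_segment t0 (fun u _ => dr_ u) (cr _ _).
  rewrite r0 !subr0 => E; exists c => //.
  by rewrite !ger0_norm.
have [c /[!in_itv]/=/andP[tc c0]] :=
  MVT_segment (ltW t0) (fun u _ => dr_ u) (cr _ _).
rewrite r0 !sub0r mulrN => /oppr_inj E; exists c => //.
by rewrite !ler0_norm// ?lerN2// ltW.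
Qed.

(** The remainder and its first two derivatives in h vanish at h = 0, so the bound on the third
    derivative can be integrated three times. *)
Lemma taylor2 f f1 f2 f3 M x h :
  (forall t : R, is_derive t 1 f (f1 t)) ->
  (forall t : R, is_derive t 1 f1 (f2 t)) ->
  (forall t : R, is_derive t 1 f2 (f3 t)) ->
  (forall t, `|t - x| <= `|h| -> `|f3 t| <= M) ->
  `|f (x + h) - f x - h * f1 x - h ^+ 2 / 2 * f2 x| <= M * `|h| ^+ 3.
Proof.
move=> df df1 df2 bf3.
have shift (g dg : R -> R) : (forall t : R, is_derive t 1 g (dg t)) ->
    forall t : R, is_derive t 1 (fun u => g (x + u)) (dg (x + t)).
  move=> dg_ t; rewrite -[dg _]mulr1; apply: is_derive1_comp.
  by apply: is_derive_eq; rewrite add0r.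
have dfx := shift _ _ df; have df1x := shift _ _ df1; have df2x := shift _ _ df2.
apply: (@le_normr_is_derive
  (fun t => f (x + t) - f x - t * f1 x - t ^+ 2 / 2 * f2 x)
  (fun t => f1 (x + t) - f1 x - t * f2 x) M h 2) => //.
- by rewrite addr0 expr0n/= !mul0r !subr0 subrr.
- move=> t; apply: is_derive_eq.
  by rewrite /GRing.scale/=; field.
apply: (@le_normr_is_derive (fun t => f1 (x + t) - f1 x - t * f2 x)
  (fun t => f2 (x + t) - f2 x) M h 1) => //.
- by rewrite addr0 !mul0r !subr0 subrr.
- move=> t; apply: is_derive_eq.
  by rewrite /GRing.scale/=; field.
apply: (@le_normr_is_derive (fun t => f2 (x + t) - f2 x)
  (fun t => f3 (x + t)) M h 0) => //.
- by rewrite addr0 subrr.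
- move=> t; apply: is_derive_eq; by rewrite subr0.
by move=> t th; rewrite expr0 mulr1; apply: bf3; rewrite addrAC subrr add0r.
Qed.

End taylor.

Section logistic.
Variable R : realType.
Implicit Types (l x a : R).

Definition logistic (l a x : R) : R := (1 + expR (l * (x - a)))^-1.

Lemma logistic_den_gt0 l a x : 0 < 1 + expR (l * (x - a)).
Proof. by rewrite addr_gt0 ?expR_gt0. Qed.

Lemma logistic_gt0 l a x : 0 < logistic l a x.
Proof. by rewrite invr_gt0 logistic_den_gt0. Qed.

Lemma logistic_lt1 l a x : logistic l a x < 1.
Proof. by rewrite invf_lt1 ?logistic_den_gt0// ltrDl expR_gt0. Qed.

(* The derivatives are polynomials in the function itself, hence bounded. *)
Let g := logistic.
Let g1 l a x := - l * (g l a x * (1 - g l a x)).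
Let g2 l a x := l ^+ 2 * (g l a x * (1 - g l a x) * (1 - 2 * g l a x)).
Let g3 l a x :=
  - l ^+ 3 * (g l a x * (1 - g l a x) * (1 - 6 * g l a x + 6 * g l a x ^+ 2)).

Lemma is_derive_logistic l a x : is_derive x 1 (logistic l a) (g1 l a x).
Proof.
rewrite /logistic.
have D : is_derive x 1 (fun x => 1 + expR (l * (x - a))) (l * expR (l * (x - a))).
  have E : is_derive x 1 (fun x => l * (x - a)) l.
    by apply: is_derive_eq; rewrite /GRing.scale/=; ring.
  rewrite -[X in is_derive _ _ _ X]add0r; apply: is_deriveD.
  by rewrite mulrC; apply: is_derive1_comp.
have n0 : 1 + expR (l * (x - a)) != 0 by rewrite gt_eqF ?logistic_den_gt0.
have V := @is_deriveV R (fun x => 1 + expR (l * (x - a))) x _ 1 n0 D.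
apply: is_derive_eq.
by rewrite /g1 /g /logistic /GRing.scale/=; field.
Qed.

(** The bounds on [b2] and on the remainder are uniform in [x], as replacing summands one at a time,
    at arbitrary points, requires. *)
Lemma logistic_taylor l a x : 0 <= l ->
  exists b1 b2, `|b2| <= l ^+ 2 /\ forall h : R,
  `|logistic l a (x + h) - logistic l a x - h * b1 - h ^+ 2 / 2 * b2|
     <= l ^+ 3 * `|h| ^+ 3.
Proof.
move=> l0.
have g0 := logistic_gt0 l a; have g1' := logistic_lt1 l a.
exists (g1 l a x), (g2 l a x); split.
  have := g0 x; have := g1' x; rewrite /g2 -/g; move: (g l a x) => y y1 y0.
  rewrite normrM ger0_norm ?exprn_ge0// ler_piMr ?exprn_ge0// ler_norml; nra.
move=> k; apply: (@taylor2 _ _ (g1 l a) (g2 l a) (g3 l a)).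
- exact: is_derive_logistic.
- move=> t; have := is_derive_logistic l a t; rewrite -/g /g1 => D.
  by apply: is_derive_eq; rewrite /g2 /GRing.scale/=; ring.
- move=> t; have := is_derive_logistic l a t; rewrite -/g /g1 => D.
  apply: is_derive_eq; rewrite /g3 /GRing.scale/=; ring.
move=> t _; have := g0 t; have := g1' t; rewrite /g3 -/g; move: (g l a t) => y y1 y0.
rewrite normrM normrN (ger0_norm (exprn_ge0 3 l0)) ler_piMr ?exprn_ge0//.
rewrite normrM mulr_ile1// ler_norml; nra.
Qed.

Lemma continuous_logistic l a : continuous (logistic l a).
Proof.
move=> x; apply: differentiable_continuous; apply/derivable1_diffP.
by have [] := is_derive_logistic l a x.
Qed.

End logistic.

(** * Gaussian smoothing *)

Section gaussian_smoothing.
Variable R : realType.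
Implicit Types (m s t v : R) (f g : R -> R).
Local Notation mu := (@lebesgue_measure R).

(** Gaussian means are taken through the density, [s] being the standard deviation, so that
    linearity, translation and Tonelli are those of Lebesgue measure. *)
Definition normal_integrable m s f :=
  mu.-integrable [set: R] (fun y => (f y * normal_pdf m s y)%:E).

Definition normal_mean m s f : R := \int[mu]_y (f y * normal_pdf m s y).

Lemma normal_integrableD m s f g :
  normal_integrable m s f -> normal_integrable m s g ->
  normal_integrable m s (fun y => f y + g y).
Proof.
move=> fi gi; apply: (eq_integrable _ _ _ _ (integrableD _ fi gi)) => //.
by move=> y _ /=; rewrite -EFinD mulrDl.
Qed.

Lemma normal_integrableZ m s k f :
  normal_integrable m s f -> normal_integrable m s (fun y => k * f y).
Proof.
move=> fi; apply: (eq_integrable _ _ _ _ (integrableZl _ k fi)) => //.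
by move=> y _ /=; rewrite -EFinM mulrA.
Qed.

Lemma normal_integrable_cst m s k : normal_integrable m s (fun=> k).
Proof.
apply: (eq_integrable _ _ _ _ (integrableZl _ k (integrable_normal_pdf m s))) => //.
Qed.

Lemma normal_integrable_le m s f g : measurable_fun setT f ->
  (forall y, `|f y| <= g y) -> normal_integrable m s g ->
  normal_integrable m s f.
Proof.
move=> mf fg; apply: le_integrable => //.
  apply/measurable_EFinP; apply: measurable_funM => //.
  exact: measurable_normal_pdf.
move=> y _; rewrite lee_fin !normrM ler_wpM2r//.
exact: le_trans (fg y) (ler_norm _).
Qed.

Lemma normal_meanD m s f g :
  normal_integrable m s f -> normal_integrable m s g ->
  normal_mean m s (fun y => f y + g y) = normal_mean m s f + normal_mean m s g.
Proof.
move=> fi gi; rewrite /normal_mean -RintegralD//.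
by apply: eq_Rintegral => y _; rewrite mulrDl.
Qed.

Lemma normal_meanZ m s k f : normal_integrable m s f ->
  normal_mean m s (fun y => k * f y) = k * normal_mean m s f.
Proof.
move=> fi; rewrite /normal_mean -RintegralZl//.
by apply: eq_Rintegral => y _; rewrite mulrA.
Qed.

Lemma normal_mean_cst m s k : normal_mean m s (fun=> k) = k.
Proof.
rewrite /normal_mean RintegralZl//; last exact: integrable_normal_pdf.
by rewrite /Rintegral integral_normal_pdf/= mulr1.
Qed.

Lemma le_normal_mean m s f g :
  normal_integrable m s f -> normal_integrable m s g ->
  (forall y, f y <= g y) -> normal_mean m s f <= normal_mean m s g.
Proof.
move=> fi gi fg; apply: le_Rintegral => // y _.
by rewrite ler_wpM2r// normal_pdf_ge0.
Qed.

Lemma normr_normal_mean_le m s f g : measurable_fun setT f ->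
  (forall y, `|f y| <= g y) -> normal_integrable m s g ->
  `|normal_mean m s f| <= normal_mean m s g.
Proof.
move=> mf fg gi; have fi := normal_integrable_le mf fg gi.
rewrite ler_norml -mulN1r -normal_meanZ//; apply/andP; split;
  apply: le_normal_mean => //.
- exact: normal_integrableZ.
- by move=> y; have := fg y; rewrite ler_norml mulN1r => /andP[].
- by move=> y; have := fg y; rewrite ler_norml => /andP[].
Qed.

(** Exponential tilting: completing the square turns the tilted density into a translated one.
    Integrability of exponentials and the moment generating function both follow. *)
Lemma normal_pdf_expRM m s t y : s != 0 ->
  expR (t * (y - m)) * normal_pdf m s y =
  expR (t ^+ 2 * s ^+ 2 / 2) * normal_pdf (m + t * s ^+ 2) s y.
Proof.
move=> s0; rewrite !normal_pdfE// /normal_fun.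
rewrite mulrCA [RHS]mulrCA -!expRD; congr (_ * expR _).
by rewrite -mulr_natr; field.
Qed.

Lemma normal_integrable_expR m s t : s != 0 ->
  normal_integrable m s (fun y => expR (t * (y - m))).
Proof.
move=> s0; have I := normal_integrable_cst (m + t * s ^+ 2) s
  (expR (t ^+ 2 * s ^+ 2 / 2)).
apply: (eq_integrable _ _ _ _ I) => [//|y _]; congr EFin.
by rewrite -normal_pdf_expRM.
Qed.

Lemma normal_mgf m s t : s != 0 ->
  normal_mean m s (fun y => expR (t * (y - m))) = expR (t ^+ 2 * s ^+ 2 / 2).
Proof.
move=> s0; rewrite -[RHS](normal_mean_cst (m + t * s ^+ 2) s).
by apply: eq_Rintegral => y _; rewrite -normal_pdf_expRM.
Qed.

Lemma normal_pdf_shift m s t y : s != 0 ->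
  normal_pdf (m + t) s (y + t) = normal_pdf m s y.
Proof.
move=> s0; rewrite !(normal_pdfE _ s0) /normal_fun.
by rewrite opprD addrACA subrr addr0.
Qed.

(** Smoothing commutes with translations, by substitution in a nonnegative continuous integrand. *)
Lemma normal_mean_shift m s t f : s != 0 -> continuous f ->
  (forall y, 0 <= f y) ->
  normal_mean (m + t) s f = normal_mean m s (fun y => f (y + t)).
Proof.
move=> s0 cf f0; rewrite /normal_mean /Rintegral; congr fine.
have dF (x : R) : is_derive x 1 (fun y : R => y + t) 1.
  by apply: is_derive_eq; rewrite addr0.
have F'E : (fun y : R => y + t)^`()%classic = cst 1.
  by apply/funext => x; rewrite derive1E derive_val.
rewrite (@increasing_ge0_integration_by_substitutionT _ (fun y => y + t)).
- apply: eq_integral => y _; rewrite F'E /= /cst fctE mulr1; congr EFin.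
  by rewrite !fctE /= normal_pdf_shift.
- by move=> x y xy; rewrite ltrD2r.
- by rewrite F'E => x; exact: cvg_cst.
- by rewrite F'E; exact: is_cvg_cst.
- by rewrite F'E; exact: is_cvg_cst.
- by move=> x; have [] := dF x.
- exact: cvg_addrr_Ny.
- exact: cvg_addrr.
- move=> x; apply: continuousM; first exact: cf.
  exact: continuous_normal_pdf.
- by move=> x; rewrite mulr_ge0 ?normal_pdf_ge0.
Qed.

End gaussian_smoothing.

Section moments.
Variable R : realType.
Implicit Types (m s t v x y : R) (f g : R -> R).

(** One term of the exponential series; it reduces polynomial moments to the moment generating
    function. *)
Lemma normrX_le_expR x n : `|x| ^+ n.+1 <= n.+1`!%:R * expR `|x|.
Proof.
have /= := expR_ge1Dxn n (normr_ge0 x).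
rewrite -ler_pdivrMl ?ltr0n ?fact_gt0// mulrC => h.
by apply: le_trans h; rewrite lerDr.
Qed.

Lemma expR_norm_le x : expR `|x| <= expR x + expR (- x).
Proof.
by have [x0|x0] := leP 0 x; rewrite ?(ger0_norm x0) ?(ltr0_norm x0) ?lerDl ?lerDr
  expR_ge0.
Qed.

Lemma expR_taylor2 x : `|expR x - 1 - x - x ^+ 2 / 2| <= expR `|x| * `|x| ^+ 3.
Proof.
have h := @taylor2 R expR expR expR expR (expR `|x|) 0 x
  (@is_derive_expR R) (@is_derive_expR R) (@is_derive_expR R).
have {}h := h _; rewrite add0r expR0 !mulr1 in h; apply: h => t tx.
rewrite ger0_norm ?expR_ge0// ler_expR; apply: le_trans tx.
by rewrite subr0 ler_norm.
Qed.

(** Combining the bounds at t and -t cancels the odd term, so |b| is of order t and hence 0. What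
    remains bounds |a| in the same way. *)
Lemma cubic_eq0 (a b C : R) :
  (forall t, `|t| <= 1 -> `|t * a + t ^+ 2 * b| <= C * `|t| ^+ 3) ->
  a = 0 /\ b = 0.
Proof.
move=> h.
have C0 : 0 <= C.
  have := h 1; rewrite normr1 !expr1n mulr1 => /(_ (lexx _)).
  by apply: le_trans.
have small (c : R) : (forall t, 0 < t <= 1 -> `|c| <= C * t) -> c = 0.
  move=> hc; apply/eqP; rewrite -normr_eq0 eq_le normr_ge0 andbT.
  apply/ler_addgt0Pl => e e0; rewrite addr0.
  have [t /andP[t0 t1] te] : exists2 t, 0 < t <= 1 & C * t <= e.
    exists (Num.min 1 (e / (C + 1))).
      by rewrite lt_min ltr01 divr_gt0// ?ltr_wpDl//= ge_min lexx.
    apply: (@le_trans _ _ (C * (e / (C + 1)))).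
      by rewrite ler_wpM2l// ge_min lexx orbT.
    rewrite mulrCA ler_piMr ?(ltW e0)// ler_pdivrMr ?ltr_wpDl//.
    by rewrite mul1r lerDl.
  by apply: le_trans te; apply: hc; rewrite t0 t1.
have hb : b = 0.
  apply: small => t /andP[t0 t1].
  have := h t; have := h (- t); rewrite normrN sqrrN (gtr0_norm t0).
  move=> /(_ t1) h1 /(_ t1) h2.
  rewrite -(ler_pM2l (exprn_gt0 2 t0)).
  rewrite -[X in X * `|b|](ger0_norm (exprn_ge0 2 (ltW t0))).
  rewrite -normrM ler_norml.
  move: h1 h2; rewrite !ler_norml => /andP[] ? ? /andP[] ? ?; nra.
split=> //; move: h; rewrite hb => h.
apply: small => t /andP[t0 t1].
have := h t; rewrite mulr0 addr0 (gtr0_norm t0) => /(_ t1).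
rewrite normrM (gtr0_norm t0) => h1.
rewrite -(ler_pM2l t0); apply: (le_trans h1).
rewrite exprS mulrCA ler_pM2l// ler_wpM2l// exprS expr1 ler_piMr// ltW//.
Qed.

Section fixed.
Variables (m s : R).
Hypothesis s0 : 0 < s.

Let sn0 : s != 0. Proof. by rewrite gt_eqF. Qed.

(** Twice the hyperbolic cosine of 2 (y - m) / s, a dominating function with explicit mean 2 e^2. *)
Let cosh2 (y : R) := expR (2 / s * (y - m)) + expR (- (2 / s) * (y - m)).

Let mcentered : measurable_fun [set: R] (fun y => y - m).
Proof. by apply: measurable_funB. Qed.

Lemma normal_integrable_centered n :
  normal_integrable m s (fun y => (y - m) ^+ n.+1).
Proof.
apply: (@normal_integrable_le _ _ _ _ (fun y => (n.+1`!)%:R *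
  (expR (1 * (y - m)) + expR (- 1 * (y - m))))).
- exact: measurable_funX.
- move=> y; rewrite normrX mul1r mulN1r; apply: (le_trans (normrX_le_expR _ _)).
  by rewrite ler_wpM2l// expR_norm_le.
- apply: normal_integrableZ; apply: normal_integrableD;
  exact: normal_integrable_expR.
Qed.

(** With x the standardized variable, |x|^3 <= 6 (e^x + e^-x), whose mean is 12 e^(1/2); the
    constant is rounded up to 12 e. *)
Lemma normal_mean_cube_le f M : measurable_fun setT f -> 0 <= M ->
  (forall y, `|f y| <= M * `|y - m| ^+ 3) ->
  `|normal_mean m s f| <= 12 * expR 1 * (M * s ^+ 3).
Proof.
move=> mf M0 fM.
pose g y := M * s ^+ 3 * 6 *
  (expR (s^-1 * (y - m)) + expR (- s^-1 * (y - m))).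
have gi t : normal_integrable m s (fun y => expR (t * (y - m))).
  exact: normal_integrable_expR.
apply: (@le_trans _ _ (normal_mean m s g)).
  apply: normr_normal_mean_le => //; last first.
    by apply: normal_integrableZ; exact: normal_integrableD.
  move=> y; apply: (le_trans (fM y)); rewrite /g.
  rewrite -(mulrA (M * s ^+ 3)) -(mulrA M) ler_wpM2l//.
  have -> : `|y - m| ^+ 3 = s ^+ 3 * `|s^-1 * (y - m)| ^+ 3.
    rewrite normrM exprMn mulrA -exprMn ger0_norm ?invr_ge0 ?ltW//.
    by rewrite divff// expr1n mul1r.
  rewrite ler_wpM2l ?exprn_ge0 ?(ltW s0)//.
  apply: (le_trans (normrX_le_expR _ _)).
  by rewrite ler_wpM2l// mulNr expR_norm_le.
rewrite normal_meanZ; last exact: normal_integrableD.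
rewrite normal_meanD// !normal_mgf// sqrrN exprVn mulVf ?expf_neq0// mul1r.
have : expR 2^-1 <= expR 1 :> R by rewrite ler_expR; lra.
have : 0 <= M * s ^+ 3 by rewrite mulr_ge0// exprn_ge0// ltW.
move: (M * s ^+ 3) (expR 2^-1) (expR 1) => A B C; nra.
Qed.

(* Both moments are read off the second-order expansion of the moment
   generating function at 0. *)
Lemma normal_mean_var :
  normal_mean m s (fun y => y - m) = 0 /\
  normal_mean m s (fun y => (y - m) ^+ 2) = s ^+ 2.
Proof.
have I1 : normal_integrable m s (fun y => y - m).
  exact: (normal_integrable_centered 0).
have I2 : normal_integrable m s (fun y => (y - m) ^+ 2).
  exact: (normal_integrable_centered 1).
set u := normal_mean m s (fun y => y - m).
set v := normal_mean m s (fun y => (y - m) ^+ 2).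
(* These are the coefficients of t and t^2 in the difference of two expansions: [E1] below, from the
   moments, and [E2], from the closed form e^(t^2/2). *)
suff [a0 b0] : u / s = 0 /\ (v / s ^+ 2 - 1) / 2 = 0.
  split; first by move/eqP: a0; rewrite mulf_eq0 invr_eq0 (negbTE sn0) orbF => /eqP.
  move/eqP: b0; rewrite mulf_eq0 invr_eq0 pnatr_eq0 orbF subr_eq0.
  by move=> /eqP/(canRL (divfK _)) ->; rewrite ?mul1r// expf_neq0.
pose C := 6 * (expR 2 + expR 2) : R.
apply: (@cubic_eq0 _ _ (C + (1 + expR 1))) => t t1.
have E1 : `|expR (t ^+ 2 / 2) - 1 - t * (u / s) - t ^+ 2 * (v / s ^+ 2) / 2|
    <= C * `|t| ^+ 3.
  pose e y := expR (t / s * (y - m)) + ((- 1) + ((- (t / s)) * (y - m) +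
      (- (t ^+ 2 / s ^+ 2 / 2)) * (y - m) ^+ 2)).
  pose g y := (`|t| ^+ 3 * 6) * cosh2 y.
  have mexp (a : R) : measurable_fun [set: R] (fun y => expR (a * (y - m))).
    by apply: measurableT_comp => //; exact: measurable_funM.
  have Iexp a : normal_integrable m s (fun y => expR (a * (y - m))).
    exact: normal_integrable_expR.
  have Ic a : normal_integrable m s (fun=> a) by exact: normal_integrable_cst.
  have IZ1 a : normal_integrable m s (fun y => a * (y - m)).
    exact: normal_integrableZ.
  have IZ2 a : normal_integrable m s (fun y => a * (y - m) ^+ 2).
    exact: normal_integrableZ.
  have IZ12 a b : normal_integrable m s (fun y => a * (y - m) + b * (y - m) ^+ 2).
    exact: (normal_integrableD (IZ1 a) (IZ2 b)).
  have -> : expR (t ^+ 2 / 2) - 1 - t * (u / s) - t ^+ 2 * (v / s ^+ 2) / 2 =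
      normal_mean m s e.
    rewrite /e normal_meanD//; last exact: normal_integrableD.
    rewrite normal_meanD// normal_meanD// normal_mean_cst !normal_meanZ//.
    rewrite -/u -/v normal_mgf// exprMn exprVn divfK ?expf_neq0//.
    by field.
  have -> : C * `|t| ^+ 3 = normal_mean m s g.
    have Icosh : normal_integrable m s cosh2 by exact: normal_integrableD.
    rewrite /g normal_meanZ// /cosh2 normal_meanD// !normal_mgf//.
    rewrite sqrrN exprMn exprVn divfK ?expf_neq0//.
    have -> : 2 ^+ 2 / 2 = 2 :> R by field.
    by rewrite /C; ring.
  apply: normr_normal_mean_le.
  - apply: measurable_funD => //; apply: measurable_funD => //.
    apply: measurable_funD; apply: measurable_funM => //.
    exact: measurable_funX.
  - move=> y; rewrite /e /g /cosh2.
    set x := (y - m) / s.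
    have -> : t / s * (y - m) = t * x by rewrite /x; ring.
    have -> : expR (t * x) + (-1 + (- (t / s) * (y - m) +
         - (t ^+ 2 / s ^+ 2 / 2) * (y - m) ^+ 2)) =
         expR (t * x) - 1 - t * x - (t * x) ^+ 2 / 2.
      by rewrite /x; field.
    apply: (le_trans (expR_taylor2 _)).
    rewrite normrM exprMn mulrCA -mulrA ler_wpM2l ?exprn_ge0//.
    (* One exponential bounds e^|tx| for |t| <= 1, the other the cube; hence the rate 2 in
       [cosh2]. *)
    apply: (@le_trans _ _ (expR `|x| * (6 * expR `|x|))).
      apply: ler_pM; [exact: expR_ge0|exact: exprn_ge0| |].
        by rewrite ler_expR ler_piMl.
      exact: normrX_le_expR.
    rewrite mulrCA ler_wpM2l// -expRD.
    have -> : 2 / s * (y - m) = 2 * x by rewrite /x; ring.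
    have -> : - (2 / s) * (y - m) = - (2 * x) by rewrite /x; ring.
    apply: le_trans (expR_norm_le _).
    by rewrite (normrM 2) (ger0_norm (ler0n R 2)) mulr_natl mulr2n.
  - by apply: normal_integrableZ; exact: normal_integrableD.
(* Expansion in h = t^2/2; the term h^2/2 is absorbed into the cubic error and accounts for the 1 in
   the constant. *)
have E2 : `|expR (t ^+ 2 / 2) - 1 - t ^+ 2 / 2| <= (1 + expR 1) * `|t| ^+ 3.
  set h := t ^+ 2 / 2.
  have t0 := normr_ge0 t.
  have hE : h = `|t| ^+ 2 / 2 by rewrite /h real_normK ?num_real.
  have := expR_taylor2 h.
  have h0 : 0 <= h by rewrite /h divr_ge0// sqr_ge0.
  rewrite (ger0_norm h0).
  have he : expR h <= expR 1 by rewrite ler_expR hE; nra.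
  have e1 := expR_ge0 (1 : R); have eh := expR_ge0 h.
  have h2 : h ^+ 2 / 2 <= `|t| ^+ 3.
    rewrite hE; move: (`|t|) t0 t1 => r r0 r1.
    have : r ^+ 4 <= r ^+ 3 by rewrite [leLHS]exprS ler_piMl// exprn_ge0.
    have -> : (r ^+ 2 / 2) ^+ 2 / 2 = r ^+ 4 / 8 by field.
    have : 0 <= r ^+ 4 by rewrite exprn_ge0.
    lra.
  have h3 : h ^+ 3 <= `|t| ^+ 3.
    rewrite lerXn2r ?nnegrE// hE; nra.
  have h4 : expR h * h ^+ 3 <= expR 1 * `|t| ^+ 3.
    by apply: ler_pM => //; exact: exprn_ge0.
  have h20 : 0 <= h ^+ 2 / 2 by rewrite divr_ge0// sqr_ge0.
  rewrite !ler_norml => /andP[A B]; move: A B h2 h4 h20.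
  move: (expR h) (expR 1) (expR h * h ^+ 3) (h ^+ 2 / 2) (`|t| ^+ 3) => a b c d e *.
  apply/andP; split; lra.
have -> : t * (u / s) + t ^+ 2 * ((v / s ^+ 2 - 1) / 2) =
  (expR (t ^+ 2 / 2) - 1 - t ^+ 2 / 2) -
  (expR (t ^+ 2 / 2) - 1 - t * (u / s) - t ^+ 2 * (v / s ^+ 2) / 2).
  by field.
apply: (le_trans (ler_normB _ _)); rewrite addrC mulrDl; exact: lerD.
Qed.

(** Gaussian half of the one-step comparison: the linear term has mean 0, the quadratic one
    contributes the variance, and the remainder costs a third moment. *)
Lemma normal_mean_taylor2 f b1 b2 M : measurable_fun setT f ->
  normal_integrable m s f -> 0 <= M ->
  (forall h, `|f (m + h) - f m - h * b1 - h ^+ 2 / 2 * b2| <= M * `|h| ^+ 3) ->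
  `|normal_mean m s f - f m - s ^+ 2 / 2 * b2| <= 12 * expR 1 * (M * s ^+ 3).
Proof.
move=> mf If M0 hf.
have [mean0 var] := normal_mean_var.
have I1 : normal_integrable m s (fun y => y - m).
  exact: (normal_integrable_centered 0).
have I2 : normal_integrable m s (fun y => (y - m) ^+ 2).
  exact: (normal_integrable_centered 1).
have IZ1 a : normal_integrable m s (fun y => a * (y - m)).
  exact: normal_integrableZ.
have IZ2 a : normal_integrable m s (fun y => a * (y - m) ^+ 2).
  exact: normal_integrableZ.
have Ic a : normal_integrable m s (fun=> a) by exact: normal_integrable_cst.
have -> : normal_mean m s f - f m - s ^+ 2 / 2 * b2 =
  normal_mean m s (fun y => f y + (- f m + ((- b1) * (y - m) +
    (- (b2 / 2)) * (y - m) ^+ 2))).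
  rewrite normal_meanD//; last first.
    by apply: normal_integrableD => //; exact: normal_integrableD.
  rewrite normal_meanD//; last exact: normal_integrableD.
  rewrite normal_meanD// normal_mean_cst !normal_meanZ// mean0 var.
  by field.
apply: normal_mean_cube_le => //.
  apply: measurable_funD => //; apply: measurable_funD => //.
  apply: measurable_funD; apply: measurable_funM => //.
  exact: measurable_funX.
move=> y; apply: le_trans (hf (y - m)); rewrite subrKC le_eqVlt; apply/orP; left.
by apply/eqP; congr (`|_|); field.
Qed.

End fixed.
End moments.

(** * The semigroup property of Gaussian smoothing *)

Section semigroup.
Variable R : realType.
Implicit Types (m s t v x y : R) (f g : R -> R).

(** Exponents of a path from x through y to z with variances A and B: given the endpoints, y is
    normal with the mean and variance in the last term. *)
Lemma complete_square (F : realFieldType) (A B x y z : F) :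
  A != 0 -> B != 0 -> A + B != 0 ->
  - (z - y) ^+ 2 / (B *+ 2) + - (y - x) ^+ 2 / (A *+ 2) =
  - (z - x) ^+ 2 / ((A + B) *+ 2) +
  - (y - (x * B + z * A) / (A + B)) ^+ 2 / ((A * B / (A + B)) *+ 2).
Proof.
move=> A0 B0 AB0; field.
by rewrite AB0 A0 B0.
Qed.

(** The joint density of midpoint and endpoint factors as the density of the endpoint times the
    conditional density of the midpoint. *)
Lemma normal_pdf_convolution a b c x y z : 0 < a -> 0 < b -> 0 < c ->
  c ^+ 2 = a ^+ 2 + b ^+ 2 ->
  normal_pdf y b z * normal_pdf x a y =
  normal_pdf x c z *
    normal_pdf ((x * b ^+ 2 + z * a ^+ 2) / c ^+ 2) (a * b / c) y.
Proof.
move=> a0 b0 c0 cE.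
have [an bn cn] : [/\ a != 0, b != 0 & c != 0] by rewrite !gt_eqF.
have dn : a * b / c != 0 by rewrite !mulf_neq0// invr_neq0.
rewrite (normal_pdfE _ an) (normal_pdfE _ bn) (normal_pdfE _ cn) (normal_pdfE _ dn).
rewrite mulrACA [RHS]mulrACA; congr *%R.
  have p0 := @pi_ge0 R.
  rewrite /normal_peak -!invfM -!sqrtrM; first last.
  - by rewrite pmulrn_lge0// mulr_ge0 ?sqr_ge0.
  - by rewrite pmulrn_lge0// mulr_ge0 ?sqr_ge0.
  congr (Num.sqrt _)^-1; move: (pi : R) => p.
  rewrite !mulrnAl !mulrnAr; congr (_ *+ 2 *+ 2).
  rewrite !exprMn exprVn mulrACA [RHS]mulrACA; congr (_ * _).
  by rewrite [RHS]mulrC divfK ?expf_neq0// mulrC.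
rewrite /normal_fun -!expRD; congr expR.
have -> : (a * b / c) ^+ 2 = a ^+ 2 * b ^+ 2 / c ^+ 2 by rewrite !exprMn exprVn.
rewrite cE; apply: complete_square; rewrite ?expf_neq0//.
by rewrite -cE expf_neq0.
Qed.

Lemma measurable_normal_pdf_pair b : b != 0 ->
  measurable_fun [set: R * R] (fun p => normal_pdf p.1 b p.2).
Proof.
move=> b0.
have -> : (fun p : R * R => normal_pdf p.1 b p.2) =
   (fun p => normal_peak b * expR (- (p.2 - p.1) ^+ 2 / (b ^+ 2 *+ 2))).
  by apply/funext => p; rewrite (normal_pdfE _ b0).
apply: measurable_funM => //; apply: measurableT_comp => //.
apply: measurable_funM => //; apply: measurableT_comp => //.
by apply: measurable_funX; apply: measurable_funB.
Qed.

Section mixture.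
Variables (a b : R) (f : R -> R).
Hypotheses (a0 : 0 < a) (b0 : 0 < b) (mf : measurable_fun setT f).
Hypothesis f01 : forall y, 0 <= f y <= 1.

Let an : a != 0. Proof. by rewrite gt_eqF. Qed.
Let bn : b != 0. Proof. by rewrite gt_eqF. Qed.

Lemma normal_integrable01 m s (g : R -> R) : measurable_fun setT g ->
  (forall y, 0 <= g y <= 1) -> normal_integrable m s g.
Proof.
move=> mg g01; apply: (normal_integrable_le mg _ (normal_integrable_cst m s 1)).
by move=> y; have /andP[? ?] := g01 y; rewrite ger0_norm.
Qed.

Lemma normal_mean01 m s (g : R -> R) : measurable_fun setT g ->
  (forall y, 0 <= g y <= 1) -> 0 <= normal_mean m s g <= 1.
Proof.
move=> mg g01; apply/andP; split.
  by apply: Rintegral_ge0 => y _; have /andP[? _] := g01 y;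
    rewrite mulr_ge0 ?normal_pdf_ge0.
rewrite -[leRHS](normal_mean_cst m s); apply: le_normal_mean.
- exact: normal_integrable01.
- exact: normal_integrable_cst.
- by move=> y; have /andP[] := g01 y.
Qed.

Lemma normal_meanE m s (g : R -> R) : measurable_fun setT g ->
  (forall y, 0 <= g y <= 1) ->
  (normal_mean m s g)%:E =
  (\int[lebesgue_measure]_y (g y * normal_pdf m s y)%:E)%E.
Proof.
move=> mg g01; rewrite /normal_mean /Rintegral fineK//.
apply: integrable_fin_num => //; exact: normal_integrable01.
Qed.

Let K x (p : R * R) : \bar R :=
  (f p.2 * (normal_pdf p.1 b p.2 * normal_pdf x a p.1))%:E.

Let mK x : measurable_fun [set: R * R] (K x).
Proof.
apply/measurable_EFinP; apply: measurable_funM.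
  exact: (measurableT_comp mf).
apply: measurable_funM; first exact: measurable_normal_pdf_pair.
by apply: (measurableT_comp (measurable_normal_pdf x a)).
Qed.

Let K0 x p : (0 <= K x p)%E.
Proof.
rewrite lee_fin mulr_ge0//; first by have /andP[] := f01 p.2.
by rewrite mulr_ge0 ?normal_pdf_ge0.
Qed.

Lemma measurable_normal_mean :
  measurable_fun [set: R] (fun y => normal_mean y b f).
Proof.
pose k (p : R * R) := (f p.2 * normal_pdf p.1 b p.2)%:E.
have mk : measurable_fun [set: R * R] k.
  apply/measurable_EFinP; apply: measurable_funM.
    exact: (measurableT_comp mf).
  exact: measurable_normal_pdf_pair.
have k0 p : (0 <= k p)%E.
  by rewrite lee_fin mulr_ge0 ?normal_pdf_ge0//; have /andP[] := f01 p.2.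
have := @measurable_fun_fubini_tonelli_F _ _ _ _ R lebesgue_measure k mk k0.
move=> mF; apply/measurable_EFinP.
apply: eq_measurable_fun mF => y _.
by rewrite /fubini_F /= normal_meanE.
Qed.

(** After Tonelli, the inner integral is that of the conditional density of the midpoint, which has
    total mass 1. *)
Lemma normal_mean_normal_mean c x : 0 < c -> c ^+ 2 = a ^+ 2 + b ^+ 2 ->
  normal_mean x a (fun y => normal_mean y b f) = normal_mean x c f.
Proof.
move=> c0 cE; apply: EFin_inj.
rewrite !normal_meanE//; [|exact: measurable_normal_mean|
  by move=> y; exact: normal_mean01].
transitivity (\int[lebesgue_measure]_y \int[lebesgue_measure]_z K x (y, z))%E.
  apply: eq_integral => y _.
  rewrite EFinM normal_meanE// -ge0_integralZr//.
  - by apply: eq_integral => z _; rewrite /K /= -EFinM mulrA.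
  - apply/measurable_EFinP; apply: measurable_funM => //.
    exact: measurable_normal_pdf.
  - by move=> z _; rewrite lee_fin mulr_ge0 ?normal_pdf_ge0//; have /andP[] := f01 z.
  - by rewrite lee_fin normal_pdf_ge0.
rewrite (@fubini_tonelli _ _ _ _ _ lebesgue_measure lebesgue_measure
  (K x) (mK x) (K0 x)).
apply: eq_integral => z _.
under eq_integral => y _.
  rewrite /K /= (normal_pdf_convolution x y z a0 b0 c0 cE) mulrA EFinM.
  over.
rewrite ge0_integralZl//.
- by rewrite integral_normal_pdf mule1.
- apply/measurable_EFinP; exact: measurable_normal_pdf.
- by move=> y _; rewrite lee_fin normal_pdf_ge0.
- by rewrite lee_fin mulr_ge0 ?normal_pdf_ge0//; have /andP[] := f01 z.
Qed.

End mixture.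
End semigroup.

(** * Lindeberg's central limit theorem *)

Section iid_mean.
Variables (R : realType) (K : finType) (p : K -> R).
Implicit Types (u : K -> R) (f g : R -> R) (x : R).

(* The expectation of [f (x + S_n)], where [S_n] is the sum of [n] independent
   copies of [u] under the law [p]. *)
Definition iid_mean u n f x : R :=
  \sum_(k : {ffun 'I_n -> K}) (\prod_i p (k i)) * f (x + \sum_i u (k i)).

Lemma iid_mean0 u f x : iid_mean u 0 f x = f x.
Proof.
rewrite /iid_mean (bigD1 (ffun0 (card_ord 0)))//= !big_ord0 mul1r.
by rewrite [X in _ + X]big1 ?addr0// => k /eqP[]; apply/ffunP => -[].
Qed.

(** Conditioning on the first summand: a finite function on [n.+1] indices is its value at 0
    together with one on [n] indices. *)
Lemma iid_meanS u n f x :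
  iid_mean u n.+1 f x = \sum_j p j * iid_mean u n f (x + u j).
Proof.
under [RHS]eq_bigr do rewrite /iid_mean big_distrr/=.
rewrite pair_big/= /iid_mean.
pose h (jk : K * {ffun 'I_n -> K}) : {ffun 'I_n.+1 -> K} :=
  [ffun i => oapp jk.2 jk.1 (unlift ord0 i)].
pose h' (k : {ffun 'I_n.+1 -> K}) := (k ord0, [ffun i => k (lift ord0 i)]).
rewrite (reindex h); last first.
  exists h' => [[j k] _|k _].
    rewrite /h' /h ffunE unlift_none /=; congr pair.
    by apply/ffunP => i; rewrite !ffunE liftK.
  apply/ffunP => i; rewrite /h /h' ffunE.
  by case: unliftP => [i' ->|->] //=; rewrite ffunE.
apply: eq_bigr => -[j k] _ /=.
rewrite !big_ord_recl /= !ffunE unlift_none /= mulrA addrA.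
by congr (_ * _ * f (_ + _)); apply: eq_bigr => i _; rewrite ffunE liftK.
Qed.

Hypothesis p0 : forall j, 0 <= p j.
Hypothesis p1 : \sum_j p j = 1.

Lemma sum_prod_prob n : \sum_(k : {ffun 'I_n -> K}) \prod_i p (k i) = 1.
Proof. by rewrite -(bigA_distr_bigA (fun (_ : 'I_n) j => p j))/= big1. Qed.

Lemma le_iid_mean u n f g c x : (forall y, f y <= g y + c) ->
  iid_mean u n f x <= iid_mean u n g x + c.
Proof.
move=> fg; rewrite -[X in _ + X]mul1r -(sum_prod_prob n) big_distrl -big_split/=.
apply: ler_sum => k _; rewrite -mulrDr ler_wpM2l//.
exact: prodr_ge0.
Qed.

Lemma normr_sum_prob_le (a b : K -> R) e :
  (forall j, `|a j - b j| <= e) ->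
  `|\sum_j p j * a j - \sum_j p j * b j| <= e.
Proof.
move=> ab; rewrite -sumrB -[leRHS]mul1r -p1 big_distrl/=.
apply: (le_trans (ler_norm_sum _ _ _)); apply: ler_sum => j _.
by rewrite -mulrBr normrM (ger0_norm (p0 j)) ler_wpM2l.
Qed.

Lemma normal_integrable_sum m s (F : K -> R -> R) (r : seq K) :
  (forall j, normal_integrable m s (F j)) ->
  normal_integrable m s (fun y => \sum_(j <- r) F j y).
Proof.
move=> FI; elim: r => [|j r ih].
  under [X in normal_integrable _ _ X]eq_fun do rewrite big_nil.
  exact: normal_integrable_cst.
under [X in normal_integrable _ _ X]eq_fun do rewrite big_cons.
exact: normal_integrableD.
Qed.

Lemma normal_mean_sum m s (F : K -> R -> R) (r : seq K) :
  (forall j, normal_integrable m s (F j)) ->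
  normal_mean m s (fun y => \sum_(j <- r) F j y) =
  \sum_(j <- r) normal_mean m s (F j).
Proof.
move=> FI; elim: r => [|j r ih].
  under [X in normal_mean _ _ X]eq_fun do rewrite big_nil.
  by rewrite normal_mean_cst big_nil.
under [X in normal_mean _ _ X]eq_fun do rewrite big_cons.
by rewrite big_cons -ih normal_meanD//; exact: normal_integrable_sum.
Qed.

(** Replacement by induction on the number of summands, each costing one error [e]. Both hypothesis
    and conclusion are uniform in [x], because the induction hypothesis is used at the shifted
    points [x + u j]. *)
Lemma lindeberg u s f e : 0 < s -> continuous f -> (forall y, 0 <= f y <= 1) ->
  (forall x, `|\sum_j p j * f (x + u j) - normal_mean x s f| <= e) ->
  forall n x,
  `|iid_mean u n.+1 f x - normal_mean x (s * Num.sqrt n.+1%:R) f| <= n.+1%:R * e.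
Proof.
move=> s0 cf f01 hf; elim => [|n ih] x.
  rewrite iid_meanS mul1r sqrtr1 mulr1.
  by under eq_bigr do rewrite iid_mean0.
have mf : measurable_fun setT f by exact: continuous_measurable_fun.
have sr n' : 0 < s * Num.sqrt n'.+1%:R by rewrite mulr_gt0// sqrtr_gt0 ltr0n.
set r := s * Num.sqrt n.+1%:R.
have r0 : 0 < r by exact: sr.
have mfu j : measurable_fun setT (fun y : R => f (y + u j)).
  by apply: measurableT_comp => //; exact: measurable_funD.
have If j : normal_integrable x r (fun y => p j * f (y + u j)).
  by apply: normal_integrableZ; apply: normal_integrable01.
have mA : measurable_fun setT (fun y : R => \sum_j p j * f (y + u j)).
  by apply: measurable_sum => j; exact: measurable_funM.
have mB : measurable_fun setT (fun y : R => normal_mean y s f).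
  exact: measurable_normal_mean.
have IB : normal_integrable x r (fun y => normal_mean y s f).
  apply: normal_integrable01 => // y; exact: normal_mean01.
rewrite -(@normal_mean_normal_mean R r s f r0 s0 mf f01 _ x (sr n.+1)); last first.
  rewrite !exprMn !sqr_sqrtr ?ler0n// -[X in _ + X]mulr1 -mulrDr.
  by rewrite -[in LHS]natr1.
rewrite iid_meanS.
rewrite -[leRHS]mulr1 -[n.+2%:R]natr1 mulrDl mul1r mulr1.
(* The intermediate term has one summand of the array and the other steps Gaussian. Translation
   reduces the first gap to the induction hypothesis; the second is a Gaussian mean of one-step
   errors. *)
apply: (le_trans (ler_distD
  (normal_mean x r (fun y => \sum_j p j * f (y + u j))) _ _)); apply: lerD.
  rewrite normal_mean_sum//.
  under [X in _ - X]eq_bigr => j _.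
    rewrite normal_meanZ; last by apply: normal_integrable01.
    rewrite -normal_mean_shift//; last 2 first.
    - by rewrite gt_eqF.
    - by move=> y; have /andP[] := f01 y.
    over.
  by apply: normr_sum_prob_le => j; exact: ih.
rewrite -mulN1r -normal_meanZ// -normal_meanD//; last 2 first.
- exact: normal_integrable_sum.
- exact: normal_integrableZ.
rewrite -[leRHS](normal_mean_cst x r); apply: normr_normal_mean_le.
- by apply: measurable_funD => //; exact: measurable_funM.
- by move=> y; rewrite mulN1r.
- exact: normal_integrable_cst.
Qed.

End iid_mean.

(** * The normal distribution function and its approximation by logistic functions *)

Section normal_cdf.
Variable R : realType.
Implicit Types (a b x y l h : R).

(** Written as a [normal_mean], so that monotonicity compares it with the means of logistic
    functions. *)
Definition normal_cdf a : R := normal_mean 0 1 (fun y => (y <= a)%R%:R).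

Lemma measurable_le_indic a : measurable_fun [set: R] (fun y => (y <= a)%R%:R : R).
Proof.
have -> : (fun y => (y <= a)%R%:R : R) = \1_`]-oo, a].
  by apply/funext => y; rewrite indicE mem_setE in_itv/=.
exact: measurable_indic.
Qed.

Lemma normal_cdfE a : normal_prob 0 1 `]-oo, a]%classic = (normal_cdf a)%:E.
Proof.
rewrite /normal_cdf normal_meanE; [|exact: measurable_le_indic|
  by move=> y; case: (y <= a)%R; rewrite ?lexx ?ler01].
rewrite /normal_prob integral_mkcond; apply: eq_integral => y _.
rewrite patchE mem_setE in_itv/=; case: (y <= a)%R; first by rewrite mul1r.
by rewrite mul0r.
Qed.

(** The density is at most [normal_peak 1]. This controls the cost of moving the threshold when a
    half-line is sandwiched. *)
Lemma normal_cdf_lipschitz a h : 0 <= h ->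
  normal_cdf (a + h) <= normal_cdf a + normal_peak 1 * h.
Proof.
move=> h0; rewrite -lee_fin EFinD -!normal_cdfE.
rewrite (_ : `]-oo, a + h] = `]-oo, a] `|` `]a, a + h])%classic; last first.
  apply/seteqP; split => y /=; rewrite !in_itv/=.
    by move=> yah; case: (leP y a) => ya; [left|right; rewrite ?ya].
  by case => [ya|/andP[]//]; apply: (le_trans ya); rewrite lerDl.
rewrite (measureU (normal_prob 0 1))//; last first.
  apply/seteqP; split => y //= []; rewrite !in_itv/= => ya /andP[ay _].
  by move: (lt_le_trans ay ya); rewrite ltxx.
apply: leeD => //; rewrite /normal_prob.
apply: (@le_trans _ _
  (\int[lebesgue_measure]_(y in `]a, (a + h)%R]) (normal_peak 1)%:E)%E).
  apply: ge0_le_integral => //.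
  - by move=> y _; rewrite lee_fin normal_pdf_ge0.
  - by apply/measurable_EFinP/measurable_funTS; exact: measurable_normal_pdf.
  - by move=> y _; rewrite lee_fin normal_pdf_ub// oner_neq0.
rewrite integral_cst//= lebesgue_measure_itv/= lte_fin ltrDl EFinM.
case: ifPn => _; first by rewrite -EFinB addrAC subrr add0r.
by rewrite mule0 -EFinM lee_fin mulr_ge0// normal_peak_ge0.
Qed.

(** With [logistic_le]: at distance at least [h] from [a], the logistic function differs from the
    indicator of the half-line by at most e^(-lh). *)
Lemma logistic_ge l a h y : 0 <= l -> y <= a - h ->
  1 - expR (- (l * h)) <= logistic l a y.
Proof.
move=> l0 yah; rewrite /logistic.
have : expR (l * (y - a)) <= expR (- (l * h)).
  by rewrite ler_expR -mulrN ler_wpM2l//; lra.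
have := expR_ge0 (l * (y - a)).
move: (expR (l * (y - a))) (expR _) => A B A0 AB.
rewrite -[leRHS]mul1r ler_pdivlMr ?ltr_wpDr//; nra.
Qed.

Lemma logistic_le l a h y : 0 <= l -> a + h <= y ->
  logistic l a y <= expR (- (l * h)).
Proof.
move=> l0 yah; rewrite /logistic expRN lef_pV2 ?posrE ?logistic_den_gt0 ?expR_gt0//.
apply: (@le_trans _ _ (expR (l * (y - a)))); last by rewrite lerDr.
by rewrite ler_expR ler_wpM2l//; lra.
Qed.

End normal_cdf.

(** * Triangular arrays under a third-moment condition *)

Section triangular_clt.
Variables (R : realType) (K : finType) (p : K -> R) (u : nat -> K -> R).
Hypothesis p0 : forall j, 0 <= p j.
Hypothesis p1 : \sum_j p j = 1.
Hypothesis u_mean : forall n, \sum_j p j * u n j = 0.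
Hypothesis u_var : n%:R * (\sum_j p j * u n j ^+ 2) @[n --> \oo] --> (1 : R).
Hypothesis u_third : n%:R * (\sum_j p j * `|u n j| ^+ 3) @[n --> \oo] --> (0 : R).

Let v n := \sum_j p j * u n j ^+ 2.
Let w n := \sum_j p j * `|u n j| ^+ 3.

(** Discrete half of the one-step comparison: centring removes the linear term. *)
Lemma sum_prob_taylor2 (n : nat) (f : R -> R) x b1 b2 M :
  (forall h, `|f (x + h) - f x - h * b1 - h ^+ 2 / 2 * b2| <= M * `|h| ^+ 3) ->
  `|\sum_j p j * f (x + u n j) - f x - v n / 2 * b2| <= M * w n.
Proof.
move=> hf.
have -> : \sum_j p j * f (x + u n j) - f x - v n / 2 * b2 = \sum_j p j *
    (f (x + u n j) - f x - u n j * b1 - u n j ^+ 2 / 2 * b2).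
  transitivity (\sum_j p j * f (x + u n j) - (\sum_j p j) * f x -
      (\sum_j p j * u n j) * b1 - v n / 2 * b2).
    by rewrite p1 u_mean mul1r mul0r subr0.
  rewrite /v !big_distrl/= -!sumrB; apply: eq_bigr => j _; ring.
rewrite /w big_distrr/=; apply: (le_trans (ler_norm_sum _ _ _)).
apply: ler_sum => j _; rewrite normrM (ger0_norm (p0 j)) mulrCA ler_wpM2l//.
Qed.

Lemma cvg_invr_sqrt : (Num.sqrt n%:R)^-1 @[n --> \oo] --> (0 : R).
Proof.
have -> : (fun n : nat => (Num.sqrt n%:R)^-1 : R) =
    (fun n : nat => Num.sqrt (n%:R^-1)).
  by apply/funext => n; rewrite sqrtrV ?ler0n.
have npos : \forall n \near \oo, 0 < (n%:R : R).
  by exists 1%N => // n /= n0; rewrite ltr0n.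
have h : (n%:R^-1 : R) @[n --> \oo] --> (0 : R).
  by apply/(gtr0_cvgV0 npos); exact: cvgr_idn.
rewrite -(@sqrtr0 R).
apply: (@continuous_cvg _ _ _ _ _ _ Num.sqrt); first exact: sqrt_continuous.
exact: h.
Qed.

(** [n] times the one-step error: the variance mismatch, the third moment of the array, and the
    third moment of a Gaussian step of deviation 1/sqrt n. *)
Let err l n : R := l ^+ 2 / 2 * `|n%:R * v n - 1| + l ^+ 3 * (n%:R * w n) +
  12 * expR 1 * l ^+ 3 * (Num.sqrt n%:R)^-1.

Let cvg_err l : err l n @[n --> \oo] --> (0 : R).
Proof.
rewrite (_ : 0 = l ^+ 2 / 2 * `|1 - 1| + l ^+ 3 * 0 + 12 * expR 1 * l ^+ 3 * 0 :> R);
  last by rewrite subrr normr0; ring.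
apply: cvgD; first apply: cvgD.
- apply: cvgMl_tmp; apply: cvg_norm; apply: cvgB; [exact: u_var|exact: cvg_cst].
- by apply: cvgMl_tmp; exact: u_third.
- by apply: cvgMl_tmp; exact: cvg_invr_sqrt.
Qed.

Lemma iid_mean_logistic l a n : 0 <= l ->
  `|iid_mean p (u n.+1) n.+1 (logistic l a) 0 - normal_mean 0 1 (logistic l a)|
  <= err l n.+1.
Proof.
move=> l0.
pose s : R := (Num.sqrt n.+1%:R)^-1.
have q0 : 0 < Num.sqrt n.+1%:R :> R by rewrite sqrtr_gt0 ltr0n.
have s0 : 0 < s by rewrite invr_gt0.
have f01 y : 0 <= logistic l a y <= 1.
  by rewrite !ltW ?logistic_gt0 ?logistic_lt1.
have cf := @continuous_logistic R l a.
have mf : measurable_fun setT (logistic l a) by exact: continuous_measurable_fun.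
have step x : `|\sum_j p j * logistic l a (x + u n.+1 j) -
    normal_mean x s (logistic l a)| <=
    l ^+ 3 * w n.+1 + (l ^+ 2 / 2 * `|v n.+1 - s ^+ 2| +
      12 * expR 1 * (l ^+ 3 * s ^+ 3)).
  have [b1 [b2 [b2l hT]]] := @logistic_taylor R l a x l0.
  have E1 := sum_prob_taylor2 n.+1 hT.
  have E2 := normal_mean_taylor2 s0 mf (normal_integrable01 x s mf f01)
    (exprn_ge0 3 l0) hT.
  set A := \sum_j _ in E1 *; set B := normal_mean _ _ _ in E2 *.
  (* Both expansions share the value at [x] and the coefficient [b2], so only the gap between the
     variances survives besides the two remainders. *)
  have -> : A - B = (A - logistic l a x - v n.+1 / 2 * b2) +
    ((v n.+1 - s ^+ 2) / 2 * b2 - (B - logistic l a x - s ^+ 2 / 2 * b2)) by field.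
  apply: (le_trans (ler_normD _ _)); apply: lerD => //.
  apply: (le_trans (ler_normB _ _)); apply: lerD => //.
  rewrite normrM normrM mulrAC [leRHS]mulrAC normfV normr_nat ler_pM2r ?invr_gt0//.
  by rewrite mulrC ler_wpM2r.
have := lindeberg p0 p1 s0 cf f01 step n 0.
rewrite /s mulVf ?gt_eqF// => /le_trans; apply.
have nE : n.+1%:R = Num.sqrt n.+1%:R ^+ 2 :> R by rewrite sqr_sqrtr ?ler0n.
rewrite /err -/s.
have -> : `|n.+1%:R * v n.+1 - 1| = n.+1%:R * `|v n.+1 - s ^+ 2|.
  rewrite -[X in X * `|_|]normr_nat -normrM mulrBr; congr (`|_ - _|).
  by rewrite {1}nE -exprMn /s divff ?gt_eqF// expr1n.
rewrite le_eqVlt; apply/orP; left; apply/eqP.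
have sE : s = n.+1%:R * s ^+ 3 by rewrite {1}nE /s; field; rewrite gt_eqF.
by rewrite {4}sE; ring.
Qed.

(** The half-line is sandwiched between logistic functions centred at a - h and a + h. One quarter
    of [e] each pays for indicator against logistic under the array, array against Gaussian,
    logistic against indicator under the Gaussian, and the shift of the threshold by 2h. First [h]
    is fixed, then the slope [l], then [n]. *)
Lemma triangular_clt a :
  iid_mean p (u n) n (fun y => (y <= a)%R%:R) 0 @[n --> \oo] --> normal_cdf a.
Proof.
rewrite -cvg_shiftS/=; apply/cvgrPdist_le => e e0.
pose h : R := e / 4 / (normal_peak 1 * 2 + 1).
have pk : 0 <= normal_peak 1 :> R by exact: normal_peak_ge0.
have h0 : 0 < h by rewrite !divr_gt0// ltr_wpDl// mulr_ge0.
have hpk : normal_peak 1 * (h + h) <= e / 4.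
  rewrite /h; move: (normal_peak 1) pk => c c0.
  have c1 : 0 < c * 2 + 1 by rewrite ltr_wpDl// mulr_ge0.
  have -> : c * (e / 4 / (c * 2 + 1) + e / 4 / (c * 2 + 1)) =
      e / 4 * (c * 2 / (c * 2 + 1)) by field; rewrite lt0r_neq0.
  by rewrite ler_piMr ?divr_ge0 ?(ltW e0)// ler_pdivrMr// mul1r lerDl.
clearbody h.
have [l l0 lh] : exists2 l : R, 0 <= l & expR (- (l * h)) <= e / 4.
  (* Then l h = 4 / e, and e^(4/e) >= 1 + 4/e. *)
  exists (4 / e / h); first by rewrite !divr_ge0 ?(ltW e0) ?(ltW h0).
  rewrite divfK ?gt_eqF// expRN -[leRHS]invrK lef_pV2 ?posrE ?expR_gt0//; last first.
    by rewrite invr_gt0 divr_gt0.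
  by rewrite invf_div; apply: le_trans (expR_ge1Dx _); rewrite lerDr.
have := cvg_err l; rewrite -cvg_shiftS/= => /cvgrPdist_le/(_ (e / 4)).
rewrite divr_gt0// => /(_ isT) ne.
near=> n; have en : err l n.+1 <= e / 4.
  apply: le_trans (ler_norm _) _; rewrite -normrN -sub0r.
  by near: n.
have L b := le_trans (iid_mean_logistic b n l0) en.
have mf b : measurable_fun setT (logistic l b).
  by apply: continuous_measurable_fun; exact: continuous_logistic.
have f01 b y : 0 <= logistic l b y <= 1.
  by rewrite !ltW ?logistic_gt0 ?logistic_lt1.
have If b : normal_integrable 0 1 (logistic l b) by exact: normal_integrable01.
have Ii b : normal_integrable (0 : R) 1 (fun y => (y <= b)%R%:R).
  apply: normal_integrable01; first exact: measurable_le_indic.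
  by move=> y; case: (y <= b)%R; rewrite ?lexx ?ler01.
have Ic c : normal_integrable (0 : R) 1 (fun=> c) by exact: normal_integrable_cst.
have up b y : logistic l b y <= (y <= b + h)%R%:R + e / 4.
  case: (leP y (b + h)) => yb /=.
    have /andP[_ h1] := f01 b y.
    by apply: ler_wpDr => //; rewrite divr_ge0// ltW.
  by rewrite add0r; apply: le_trans lh; apply: logistic_le => //; exact: ltW.
have lo b y : (y <= b - h)%R%:R <= logistic l b y + e / 4.
  case: (leP y (b - h)) => yb /=; last first.
    by have /andP[h1 _] := f01 b y; rewrite addr_ge0// divr_ge0// ltW.
  by rewrite -lerBlDr; apply: le_trans (logistic_ge l0 yb); rewrite lerB.
rewrite ler_norml; apply/andP; split.
- have h1 : iid_mean p (u n.+1) n.+1 (fun y => (y <= a)%R%:R) 0 <=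
      iid_mean p (u n.+1) n.+1 (logistic l (a + h)) 0 + e / 4.
    by apply: le_iid_mean => // y; have := lo (a + h) y; rewrite addrK.
  have h2 : normal_mean 0 1 (logistic l (a + h)) <= normal_cdf (a + (h + h)) + e / 4.
    rewrite -[X in _ <= _ + X](normal_mean_cst 0 1) /normal_cdf -normal_meanD//.
    apply: le_normal_mean => //; first exact: normal_integrableD.
    by move=> y; have := up (a + h) y; rewrite addrA.
  have h3 := normal_cdf_lipschitz a (addr_ge0 (ltW h0) (ltW h0)).
  have := L (a + h); rewrite ler_norml => /andP[h4 h5].
  clear -h1 h2 h3 h4 h5 hpk; lra.
- have h1 : iid_mean p (u n.+1) n.+1 (logistic l (a - h)) 0 <=
      iid_mean p (u n.+1) n.+1 (fun y => (y <= a)%R%:R) 0 + e / 4.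
    by apply: le_iid_mean => // y; have := up (a - h) y; rewrite subrK.
  have h2 : normal_cdf (a - (h + h)) <= normal_mean 0 1 (logistic l (a - h)) + e / 4.
    rewrite -[X in _ <= _ + X](normal_mean_cst 0 1) /normal_cdf -normal_meanD//.
    apply: le_normal_mean => //; first exact: normal_integrableD.
    by move=> y; have := lo (a - h) y; rewrite opprD addrA.
  have := normal_cdf_lipschitz (a - (h + h)) (addr_ge0 (ltW h0) (ltW h0)).
  rewrite subrK => h3.
  have := L (a - h); rewrite ler_norml => /andP[h4 h5].
  clear -h1 h2 h3 h4 h5 hpk; lra.
Unshelve. all: by end_near.
Qed.

End triangular_clt.

(** * The truncated and censored sample *)

Section finite_partition.
Context d (Omega : measurableType d) (R : realType) (P : probability Omega R).

Lemma measure_seq_fibers (I : finType) (h : Omega -> I) (E : set Omega)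
    (r : seq I) :
  (forall i, measurable (h @^-1` [set i])) -> measurable E -> uniq r ->
  P (E `&` [set w | h w \in r]) = (\sum_(i <- r) P (E `&` h @^-1` [set i]))%E.
Proof.
move=> mh mE; elim: r => [_|i r ih /= /andP[ir ur]].
  rewrite big_nil (_ : _ `&` _ = set0) ?measure0//.
  by apply/seteqP; split => // w [].
have mr : measurable [set w | h w \in r].
  rewrite (_ : mkset _ = \bigcup_(j in [set` r]) (h @^-1` [set j])).
    by apply: fin_bigcup_measurable => //; exact: finite_seq.
  apply/seteqP; split => [w hr|w [j jr /= hj]]; first by exists (h w).
    by rewrite /= hj.
rewrite big_cons -ih// -measureU.
- congr (P _); rewrite -setIUr; congr setI.
  apply/seteqP; split => w /=; rewrite in_cons.
    by move=> /orP[/eqP|] hw; [left|right].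
  by move=> [->|->]; rewrite ?eqxx ?orbT.
- exact: measurableI.
- exact: measurableI.
- by apply/seteqP; split => // w /= [[_ ->] [_]]; rewrite (negbTE ir).
Qed.

Lemma prob_partition (I : finType) (h : Omega -> I) (E : set Omega) :
  (forall i, measurable (h @^-1` [set i])) -> measurable E ->
  fine (P E) = \sum_i fine (P (E `&` h @^-1` [set i])).
Proof.
move=> mh mE; rewrite sum_fine; last first.
  by move=> i _; apply: fin_num_measure; exact: measurableI.
rewrite -measure_seq_fibers ?index_enum_uniq//; congr (fine (P _)).
by apply/seteqP; split => [w Ew|w []//]; split => //=; rewrite mem_index_enum.
Qed.

(** Transfer to a finite sample space: an event decided by the values of the [h i] becomes a sum
    under the product law, the form handled by [iid_mean]. *)
Lemma prob_finite_test (K : finType) (p : K -> R) (n : nat)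
    (h : nat -> Omega -> K) (test : pred {ffun 'I_n -> K}) :
  (forall i k, measurable (h i @^-1` [set k])) ->
  (forall k : {ffun 'I_n -> K}, P [set w | forall i : 'I_n, h i w = k i] =
     (\prod_i p (k i))%:E) ->
  P [set w | test [ffun i : 'I_n => h i w]] =
  (\sum_(k : {ffun 'I_n -> K}) (\prod_i p (k i)) * (test k)%:R)%:E.
Proof.
move=> mh hp.
pose H w := [ffun i : 'I_n => h i w].
have HE k : H @^-1` [set k] = [set w | forall i : 'I_n, h i w = k i].
  apply/seteqP; split => w /= => [<- i|hk]; first by rewrite ffunE.
  by apply/ffunP => i; rewrite ffunE.
have mH k : measurable (H @^-1` [set k]).
  rewrite HE (_ : mkset _ = \bigcap_(i in [set: 'I_n]) (h i @^-1` [set k i])).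
    by apply: fin_bigcap_measurable => //; exact: finite_finset.
  by apply/seteqP; split => [w hk i _|w hk i]; [exact: hk|exact: (hk i)].
have mT : measurable [set w | test (H w)].
  rewrite (_ : mkset _ = \bigcup_(k in [set k | test k]) (H @^-1` [set k])).
    by apply: fin_bigcup_measurable => //; exact: finite_finset.
  apply/seteqP; split => [w hk|w [k hk /= hwk]]; first by exists (H w).
  by rewrite /= hwk.
rewrite -[LHS]fineK ?fin_num_measure//; congr EFin.
rewrite (prob_partition mH mT); apply: eq_bigr => k _.
case: (boolP (test k)) => tk.
  rewrite mulr1 setIidr; first by rewrite HE hp.
  by move=> w /= ->.
rewrite mulr0 (_ : _ `&` _ = set0) ?measure0//.
by apply/seteqP; split => // w /= [] /[swap] ->; rewrite (negbTE tk).
Qed.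

End finite_partition.

(** * Sums over observation windows and moments of a capped geometric age *)

Section window_sums.
Variable R : realType.

(** Since t < G and m <= s, the window from t + 1 to t + m lies inside the range of summation. *)
Lemma sum_window (G s t m : nat) (F : nat -> R) : (t < G)%N -> (m <= s)%N ->
  \sum_(1 <= x < s + G) (t < x <= t + m)%N%:R * F x =
  \sum_(i < m) F (t + i).+1.
Proof.
move=> tG ms.
rewrite (@big_cat_nat _ _ _ t.+1)//=; last exact: (leq_trans tG (leq_addl _ _)).
have -> : \sum_(1 <= x < t.+1) (t < x <= t + m)%N%:R * F x = 0.
  rewrite big_nat_cond big1// => x /andP[/andP[_ xt] _].
  by rewrite ltnNge -ltnS xt mul0r.
rewrite add0r (@big_cat_nat _ _ _ (t + m).+1)//=; last 2 first.
- by rewrite ltnS leq_addr.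
- by rewrite -addSn [(t.+1 + m)%N]addnC leq_add.
rewrite [X in _ + X](_ : _ = 0) ?addr0; last first.
  rewrite big_nat_cond big1// => x /andP[/andP[xt _] _].
  by rewrite [(x <= _)%N]leqNgt xt /= andbF mul0r.
rewrite -addSn -{1}[t.+1]add0n big_addn addKn big_mkord.
by apply: eq_bigr => i _; rewrite addnS addnC ltnS leq_addr ltn_add2l ltn_ord mul1r.
Qed.

Variables (theta : R).
Let q := 1 - theta.

(** The mean of a geometric age capped at s, as the sum of its tail probabilities. *)
Lemma sum_geometric_expr s :
  \sum_(i < s) theta * q ^+ i * i.+1%:R + q ^+ s * s%:R = \sum_(i < s) q ^+ i.
Proof.
elim: s => [|s ih]; first by rewrite !big_ord0 mulr0 addr0.
rewrite !big_ord_recr/= -ih (exprS q) -[s.+1%:R]natr1.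
by rewrite /q; ring.
Qed.

(** A martingale identity: in each year at risk the event indicator minus [theta] is centred. In
    [sum_geometric_score_sqr] each such year adds its conditional variance theta q. *)
Lemma sum_geometric_score s :
  \sum_(i < s) theta * q ^+ i * (1 - theta * i.+1%:R)
    + q ^+ s * (0 - theta * s%:R) = 0.
Proof.
elim: s => [|s ih]; first by rewrite !big_ord0 mulr0 subr0 mulr0 addr0.
rewrite -[RHS]ih !big_ord_recr/= (exprS q) -[s.+1%:R]natr1.
by rewrite /q; ring.
Qed.

Lemma sum_geometric_score_sqr s :
  \sum_(i < s) theta * q ^+ i * (1 - theta * i.+1%:R) ^+ 2
    + q ^+ s * (0 - theta * s%:R) ^+ 2 = theta * q * \sum_(i < s) q ^+ i.
Proof.
elim: s => [|s ih]; first by rewrite !big_ord0 !mulr0 subr0 expr0n mulr0 addr0.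
rewrite !big_ord_recr/= [RHS]mulrDr -ih (exprS q) -[s.+1%:R]natr1.
by rewrite /q; ring.
Qed.

End window_sums.

(** * The law of the observed age of one unit *)

Section geometric_lifetime.
Context d (Omega : measurableType d) (R : realType) (P : probability Omega R).
Variables (theta : R) (X : {RV P >-> nat}).
Let q := 1 - theta.
Hypothesis theta01 : 0 < theta < 1.
Hypothesis hX : forall x : nat, (1 <= x)%N ->
    P [set w | X w = x] = (theta * q ^+ x.-1)%:E.

(** The masses at x >= 1 only show that P(X > k) - q^k is constant in k. The constant is at most 0
    at k = 0, and a negative one would make the tail negative as q^k tends to 0. Thus X = 0 has
    probability 0. *)
Lemma geometric_tail k : P [set w | (k < X w)%N] = (q ^+ k)%:E.
Proof.
have mX (A : set nat) : measurable [set w | A (X w)].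
  by rewrite -[mkset _]/(X @^-1` A); exact: measurable_funPTI.
have fP A : measurable A -> P A \is a fin_num by exact: fin_num_measure.
pose a k := fine (P [set w | (k < X w)%N]).
have aE j : (a j)%:E = P [set w | (j < X w)%N].
  by rewrite fineK// fP//; exact: (mX [set x | (j < x)%N]).
have aS j : a j = theta * q ^+ j + a j.+1.
  apply: EFin_inj; rewrite EFinD !aE -(hX (ltn0Sn j)) -measureU.
  - congr (P _); apply/seteqP; split => w /=.
      by rewrite leq_eqVlt => /orP[/eqP <-|]; [left|right].
    by move=> [->|/ltnW].
  - exact: (mX [set j.+1]).
  - exact: (mX [set x | (j.+1 < x)%N]).
  - by apply/seteqP; split => // w /= [->]; rewrite ltnn.
have aq j : a j - q ^+ j = a 0 - 1.
  elim: j => [|j ih]; first by rewrite expr0.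
  by rewrite -ih (aS j) exprS /q; ring.
have a1 : a 0 <= 1.
  by rewrite -lee_fin aE probability_le1//; exact: (mX [set x | (0 < x)%N]).
have /andP[t0 t1] := theta01.
have q1 : `|q| < 1 by rewrite ger0_norm /q; lra.
have a0 : a 0 = 1.
  apply/eqP; rewrite eq_le a1/=.
  rewrite leNgt; apply/negP => a0lt.
  have c0 : 0 < 1 - a 0 by rewrite subr_gt0.
  have [N _ /(_ N (leqnn N)) /=] := @cvgr_lt _ _ _ _ _ _ (cvg_expr q1) _ c0.
  have := aq N; have : 0 <= a N by rewrite /a fine_ge0.
  move: (a N) (q ^+ N) => b c; lra.
rewrite -aE; congr EFin; have := aq k; rewrite a0 subrr => /eqP.
by rewrite subr_eq0 => /eqP.
Qed.

Section truncated.
Variables (T : {RV P >-> nat}) (G : nat).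
Hypothesis hT : forall w : Omega, (T w < G)%N.
Hypothesis hXT : independent_RV2 X T.

Let tau (t : nat) : R := fine (P (T @^-1` [set t])).

Lemma prob_independent_rel (r : nat -> nat -> bool) :
  fine (P [set w | r (X w) (T w)]) =
  \sum_(t < G) fine (P [set w | r (X w) t]) * tau t.
Proof.
pose h w : 'I_G := Ordinal (hT w).
have hE (t : 'I_G) : h @^-1` [set t] = T @^-1` [set (t : nat)].
  apply/seteqP; split => w /=; first by move=> <-.
  by move=> E; apply: val_inj.
have mh t : measurable (h @^-1` [set t]) by rewrite hE; exact: measurable_funPTI.
rewrite (prob_partition P mh); last exact: measurable_nat_rel.
apply: eq_bigr => t _; rewrite hE.
rewrite (_ : _ `&` _ = (X @^-1` [set x | r x t]) `&` (T @^-1` [set (t : nat)])).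
  rewrite hXT// fineM ?fin_num_measure//; exact: measurable_funPTI.
by apply/seteqP; split => w /= [] /[swap] ->.
Qed.

(** The probability P(T < X) that a unit is observed. *)
Definition trunc_mass : R := \sum_(t < G) tau t * q ^+ t.

(** It is at least q^G, all truncation times being below [G]. *)
Lemma trunc_mass_gt0 : 0 < trunc_mass.
Proof.
have /andP[t0 t1] := theta01.
have q0 : 0 < q by rewrite /q; lra.
have tau0 t : 0 <= tau t by rewrite fine_ge0.
have tau1 : \sum_(t < G) tau t = 1.
  have := prob_independent_rel (fun _ _ => true).
  rewrite (_ : [set w | true] = setT); last by apply/seteqP; split.
  rewrite probability_setT /= => ->; apply: eq_bigr => t _.
  by rewrite mul1r.
apply: (@lt_le_trans _ _ (q ^+ G)); first exact: exprn_gt0.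
rewrite -[leLHS]mul1r -tau1 big_distrl; apply: ler_sum => t _.
apply: ler_wpM2l => //; apply: ler_wiXn2l; [exact: ltW| |exact/ltnW].
by rewrite /q; lra.
Qed.

Variable s : nat.

(* The junk value 0 of the truncated subtraction stands for an unobserved unit,
   the cap [s.+1] for a censored one. *)
Definition observed_age w : 'I_s.+2 := inord (minn (X w - T w) s.+1).

Lemma val_observed_age w : observed_age w = minn (X w - T w) s.+1 :> nat.
Proof. by rewrite /observed_age inordK// ltnS geq_minr. Qed.

Definition age_prob (k : 'I_s.+2) : R := fine (P (observed_age @^-1` [set k])).

Lemma observed_age_fiber k : observed_age @^-1` [set k] =
  [set w | minn (X w - T w) s.+1 == k].
Proof.
apply/seteqP; split => w /=; first by move=> <-; rewrite val_observed_age.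
by move=> /eqP E; apply: val_inj; rewrite /= val_observed_age.
Qed.

Lemma measurable_observed_age k : measurable (observed_age @^-1` [set k]).
Proof.
rewrite observed_age_fiber.
exact: (measurable_nat_rel (fun x t => minn (x - t) s.+1 == k)).
Qed.

Lemma age_prob_ge0 k : 0 <= age_prob k.
Proof. by rewrite fine_ge0. Qed.

Lemma sum_age_prob : \sum_k age_prob k = 1.
Proof.
have := prob_partition P measurable_observed_age measurableT.
rewrite probability_setT /= => ->.
by apply: eq_bigr => k _; rewrite setTI.
Qed.

(** Lack of memory: P(X = t + i) is q^t times the geometric mass at i, so the sum over t separates.
    The censored mass in [age_prob_max] factors likewise. *)
Lemma age_prob_pos (i : 'I_s.+2) : (0 < i <= s)%N ->
  age_prob i = trunc_mass * (theta * q ^+ i.-1).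
Proof.
move=> /andP[i0 is_]; rewrite /age_prob observed_age_fiber.
rewrite (prob_independent_rel (fun x t => minn (x - t) s.+1 == i)).
rewrite /trunc_mass big_distrl/=; apply: eq_bigr => t _.
rewrite (_ : [set w | _] = [set w | X w = (t + i)%N]).
  rewrite hX ?addn_gt0 ?i0 ?orbT//=.
  have -> : (t + i).-1 = (t + i.-1)%N by case: (i : nat) i0 => // j _; rewrite addnS.
  by rewrite exprD; ring.
apply/seteqP; split => w /=; last first.
  by move=> ->; rewrite addKn; apply/eqP/minn_idPl/leqW.
move=> /eqP; lia.
Qed.

Lemma age_prob_max : age_prob ord_max = trunc_mass * q ^+ s.
Proof.
rewrite /age_prob observed_age_fiber.
rewrite (prob_independent_rel (fun x t => minn (x - t) s.+1 == s.+1)).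
rewrite /trunc_mass big_distrl/=; apply: eq_bigr => t _.
rewrite (_ : [set w | _] = [set w | (t + s < X w)%N]).
  by rewrite geometric_tail /= exprD; ring.
by apply/seteqP; split => w /=; [move=> /eqP; lia|move=> ?; apply/eqP; lia].
Qed.

(** Censored units alone have positive mass. Hence the probability that none of n units is observed
    decays geometrically. *)
Lemma age_prob0_lt1 : age_prob ord0 < 1.
Proof.
have /andP[t0 t1] := theta01.
rewrite -sum_age_prob (bigD1 ord0)//= ltrDl (bigD1 ord_max)//=.
apply: ltr_pwDl; last by apply: sumr_ge0 => k _; exact: age_prob_ge0.
by rewrite age_prob_max mulr_gt0 ?trunc_mass_gt0// exprn_gt0//; rewrite /q; lra.
Qed.

(** Unobserved units have age 0 and contribute nothing, which leaves a geometric age capped at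
    [s.+1]. *)
Lemma sum_age_prob_mul (h : nat -> R) : h 0%N = 0 ->
  \sum_k age_prob k * h k = trunc_mass *
    (\sum_(i < s) theta * q ^+ i * h i.+1 + q ^+ s * h s.+1).
Proof.
move=> h0; rewrite big_ord_recl/= h0 mulr0 add0r big_ord_recr/= mulrDr.
congr (_ + _).
  rewrite big_distrr/=; apply: eq_bigr => i _.
  rewrite age_prob_pos/=; last by rewrite /bump/= add1n ltn_ord.
  by rewrite /bump/= add1n add0n -[LHS]mulrA.
rewrite (_ : lift ord0 ord_max = ord_max); last by apply: val_inj.
by rewrite age_prob_max /bump/= add1n mulrA.
Qed.

(* [event_count k] and [exposure k] are the observed event indicator and the
   observed time at risk of a unit of observed age [k]. *)
Definition event_count (k : nat) : R := (0 < k <= s)%N%:R.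
Definition exposure (k : nat) : R := (minn k s)%:R.
Definition score (k : nat) : R := event_count k - theta * exposure k.

Definition mean_exposure : R := \sum_k age_prob k * exposure k.

Lemma mean_exposureE : mean_exposure = trunc_mass * \sum_(i < s) q ^+ i.
Proof.
rewrite /mean_exposure sum_age_prob_mul; last by rewrite /exposure min0n.
rewrite -(sum_geometric_expr theta); congr (_ * (_ + _)).
  by apply: eq_bigr => i _; rewrite /exposure (minn_idPl _).
by rewrite /exposure (minn_idPr _).
Qed.

Lemma score0 : score 0 = 0.
Proof. by rewrite /score /event_count /exposure min0n mulr0 subr0. Qed.

Lemma scoreS i : (i < s)%N -> score i.+1 = 1 - theta * i.+1%:R.
Proof. by move=> is_; rewrite /score /event_count /exposure is_ (minn_idPl _). Qed.

Lemma score_max : score s.+1 = 0 - theta * s%:R.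
Proof. by rewrite /score /event_count /exposure ltnn (minn_idPr _). Qed.

Lemma mean_score : \sum_k age_prob k * score k = 0.
Proof.
rewrite sum_age_prob_mul ?score0// score_max.
under eq_bigr => i _ do rewrite scoreS//.
by rewrite sum_geometric_score mulr0.
Qed.

Lemma mean_score_sqr :
  \sum_k age_prob k * score k ^+ 2 = theta * q * mean_exposure.
Proof.
rewrite (sum_age_prob_mul (h := fun k => score k ^+ 2)) ?score0 ?expr0n//.
rewrite score_max; under eq_bigr => i _ do rewrite scoreS//.
by rewrite sum_geometric_score_sqr mean_exposureE mulrCA.
Qed.

End truncated.
End geometric_lifetime.

(** * The estimator and its asymptotic variance in terms of observed ages *)

Section sample.
Context d (Omega : measurableType d) (R : realType) (P : probability Omega R).
Variable s : nat.

Lemma measurable_nat_pair (A : set (nat * nat)) : measurable A.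
Proof.
apply: countable_measurable; last exact: countableP.
move=> [x y]; rewrite (_ : [set (x, y)] = [set x] `*` [set y]).
  exact: measurableX.
by apply/seteqP; split => [z ->//|[a b] [/= -> ->]].
Qed.

Lemma prob_observed_ages (X T : nat -> {RV P >-> nat}) (n : nat)
    (k : {ffun 'I_n -> 'I_s.+2}) :
  iid (fun i => pair_RV (X i) (T i)) ->
  P [set w | forall i : 'I_n, observed_age (X i) (T i) s w = k i] =
  (\prod_i age_prob (X 0) (T 0) (k i))%:E.
Proof.
move=> [ind idd].
pose B (j : 'I_s.+2) : set (nat * nat) := [set z | minn (z.1 - z.2) s.+1 == j].
have BE i j : pair_RV (X i) (T i) @^-1` (B j) =
    observed_age (X i) (T i) s @^-1` [set j].
  by rewrite observed_age_fiber.
(* Mutual independence takes events indexed by all of [nat]; beyond the sample they are the whole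
   space. *)
pose A (i : nat) : set (nat * nat) := if insub i is Some j then B (k j) else setT.
have mA i : measurable (A i) by exact: measurable_nat_pair.
have AE (i : 'I_n) : A i = B (k i) by rewrite /A valK.
pose J : {fset nat} := [fset i | i in iota 0 n]%fset.
have := ind J A mA.
have -> : \bigcap_(i in [set` J]) pair_RV (X i) (T i) @^-1` A i =
    [set w | forall i : 'I_n, observed_age (X i) (T i) s w = k i].
  have Bw i j w : B j (X i w, T i w) = (observed_age (X i) (T i) s w == j).
    by rewrite /B /= -(inj_eq val_inj) /= val_observed_age.
  apply/seteqP; split => w /= h i.
    apply/eqP; rewrite -Bw -AE; apply: (h i).
    by rewrite /= !inE /= mem_iota add0n ltn_ord.
  rewrite /= !inE /= mem_iota add0n => /= i_n.
  by have := AE (Ordinal i_n) => /= ->; rewrite Bw; apply/eqP/(h (Ordinal i_n)).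
move=> ->.
have pJ : perm_eq (enum_fset J) (iota 0 n).
  by apply: uniq_perm; rewrite ?fset_uniq ?iota_uniq// => i; rewrite !inE.
rewrite (perm_big _ pJ)/= -[n in iota _ n]subn0 -/(index_iota 0 n) big_mkord.
rewrite -prodEFin; apply: eq_bigr => i _.
rewrite AE /age_prob fineK ?fin_num_measure//; last exact: measurable_observed_age.
rewrite -(BE 0%N); exact: (idd i 0%N _ (measurable_nat_pair _)).
Qed.

(** At risk at x - 1 means T < x <= T + min(X - T, s), a window whose length is the exposure; it is
    empty for a truncated unit. *)
Lemma sum_TYc (G : nat) (X T : {RV P >-> nat}) w : (T w < G)%N ->
  \sum_(1 <= x < s + G) TYc s X T x.-1 w = exposure R s (observed_age X T s w).
Proof.
move=> tG; rewrite val_observed_age.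
rewrite (eq_big_nat _ _ (F2 := fun x =>
    (T w < x <= T w + minn (X w - T w) s)%N%:R * 1)); last first.
  move=> x /andP[x1 _]; rewrite /TYc /= !indicE !mem_setE mulr1 -!natrM !mulnb.
  by congr (_%:R); congr nat_of_bool; rewrite prednK//; lia.
rewrite sum_window ?geq_minr// sumr_const card_ord /exposure.
by rewrite -minnA (minn_idPr (leqnSn s)).
Qed.

(** The numerator telescopes to the count at s + G - 1, the count at 0 being 0. As T < G, every
    uncensored event has occurred by then. *)
Lemma theta_hatE (G n : nat) (X T : nat -> {RV P >-> nat}) w : (1 <= G)%N ->
  (forall i w, (T i w < G)%N) ->
  theta_hat s G X T n w =
  (\sum_(i < n) event_count R s (observed_age (X i) (T i) s w)) /
  (\sum_(i < n) exposure R s (observed_age (X i) (T i) s w)).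
Proof.
move=> G1 hT; rewrite /theta_hat /= /theta_hat_fun; congr (_ / _); last first.
  by rewrite /TYc_sum exchange_big/=; apply: eq_bigr => i _; rewrite sum_TYc.
rewrite /increment big_add1/= telescope_sumr//.
rewrite /TNc_sum -sumrB; apply: eq_bigr => i _.
rewrite /TNc !indicE !mem_setE val_observed_age /event_count.
rewrite [X in _ - X%:R](_ : _ = 0%N) ?subr0; last by apply/eqP; rewrite eqb0; lia.
by congr (_%:R); congr nat_of_bool; have := hT i w; lia.
Qed.

(** The expected exposure is summed year by year: for a fixed truncation time t, the tails q^(x-1)
    over its window add up to q^t times the mean capped age. *)
Lemma PB_sigma2E (G : nat) (theta0 : R) (X T : nat -> {RV P >-> nat}) :
  0 < theta0 < 1 ->
  (forall x : nat, (1 <= x)%N ->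
    P [set w | X 0 w = x] = (theta0 * (1 - theta0) ^+ x.-1)%:E) ->
  (forall w, (T 0 w < G)%N) -> independent_RV2 (X 0) (T 0) ->
  PB_sigma2 s G theta0 X T =
  (theta0 * (1 - theta0))^-1 * mean_exposure (X 0) (T 0) s.
Proof.
move=> th hX hT hXT; rewrite /PB_sigma2; congr (_ * _).
rewrite (mean_exposureE th hX hT hXT).
set q := 1 - theta0.
transitivity (\sum_(1 <= x < s + G) \sum_(t < G)
    (t < x <= t + s)%N%:R * (q ^+ x.-1 * fine (P (T 0 @^-1` [set (t : nat)])))).
  apply: eq_big_nat => x /andP[x1 _].
  rewrite (_ : TYc _ _ _ _ =
    \1_[set w | (T 0 w < x <= T 0 w + s)%N && (x <= X 0 w)%N]); last first.
    apply/funext => w; rewrite /TYc /= !indicE !mem_setE -!natrM !mulnb.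
    by congr (_%:R); congr nat_of_bool; rewrite prednK//; lia.
  rewrite expectation_indic; last first.
    exact: (measurable_nat_rel (fun a t => (t < x <= t + s)%N && (x <= a)%N)).
  rewrite (prob_independent_rel hT hXT
    (fun a t => (t < x <= t + s)%N && (x <= a)%N)).
  apply: eq_bigr => t _; case: (t < x <= t + s)%N => /=; last first.
    rewrite (_ : [set w | false] = set0); last by apply/seteqP; split.
    by rewrite measure0 /= !mul0r.
  rewrite mul1r (_ : [set w | _] = [set w | (x.-1 < X 0 w)%N]).
    by rewrite (geometric_tail th hX).
  by rewrite prednK.
rewrite exchange_big/= /trunc_mass big_distrl/=; apply: eq_bigr => t _.
rewrite sum_window// big_distrr/=; apply: eq_bigr => i _.
by rewrite exprD; ring.
Qed.

End sample.

(** * From the estimator to a centred array *)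

Section estimator_limit.
Variables (R : realType).

Lemma cvg_sum_prob (K : finType) (p : K -> R) (D : nat -> K -> R) (W : K -> R)
    (m : nat) :
  (forall k, D n k @[n --> \oo] --> W k) ->
  \sum_k p k * D n k ^+ m @[n --> \oo] --> \sum_k p k * W k ^+ m.
Proof.
move=> DW; apply: cvg_big => [|k _]; first exact: add_continuous.
apply: cvgMl_tmp.
apply: (@continuous_cvg _ _ _ _ _ _ (fun y : R => y ^+ m)) => //.
exact: exprn_continuous.
Qed.

(** As [K] is finite, pointwise convergence of [D n] carries over to its moments, so the
    third-moment condition holds at rate 1/sqrt n. *)
Lemma clt_sqrt_array (K : finType) (p : K -> R) (D : nat -> K -> R)
    (W : K -> R) (sigma a : R) : 0 < sigma ->
  (forall j, 0 <= p j) -> \sum_j p j = 1 ->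
  (forall n, \sum_j p j * D n j = 0) ->
  (forall j, D n j @[n --> \oo] --> W j) ->
  \sum_j p j * W j ^+ 2 = sigma ^+ 2 ->
  iid_mean p (fun j => D n j / (Num.sqrt n%:R * sigma)) n
    (fun y => (y <= a)%R%:R) 0 @[n --> \oo] --> normal_cdf a.
Proof.
move=> s0 p0 p1 D0 DW WE.
have sq n : (0 < n)%N -> Num.sqrt n%:R != 0 :> R.
  by move=> n0; rewrite gt_eqF// sqrtr_gt0 ltr0n.
have sn : sigma != 0 by rewrite gt_eqF.
apply: (triangular_clt (u := fun n j => D n j / (Num.sqrt n%:R * sigma))) => //.
- move=> n; transitivity ((\sum_j p j * D n j) / (Num.sqrt n%:R * sigma)).
    rewrite big_distrl/=.
    by apply: eq_bigr => j _; rewrite mulrA.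
  by rewrite D0 mul0r.
- have h : (sigma ^+ 2)^-1 * (\sum_j p j * D n j ^+ 2) @[n --> \oo] --> (1 : R).
    rewrite -[X in _ --> X](@mulVf _ (sigma ^+ 2)) ?expf_neq0// -WE.
    by apply: cvgMl_tmp; exact: cvg_sum_prob.
  apply: cvg_trans h; apply: near_eq_cvg; exists 1%N => // n /= n0.
  rewrite !big_distrr/=; apply: eq_bigr => j _.
  have nE : n%:R = Num.sqrt n%:R ^+ 2 :> R by rewrite sqr_sqrtr ?ler0n.
  by rewrite {1}nE; field; rewrite sn sq.
- have h : (sigma ^+ 3)^-1 * (\sum_j p j * `|D n j| ^+ 3) * (Num.sqrt n%:R)^-1
      @[n --> \oo] --> (0 : R).
    rewrite -[X in _ --> X](mulr0 ((sigma ^+ 3)^-1 * \sum_j p j * `|W j| ^+ 3)).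
    apply: cvgM; last exact: cvg_invr_sqrt.
    apply: cvgMl_tmp; apply: (@cvg_sum_prob _ p (fun n j => `|D n j|)) => k.
    by apply: cvg_norm.
  apply: cvg_trans h; apply: near_eq_cvg; exists 1%N => // n /= n0.
  rewrite !big_distrr/= big_distrl/=; apply: eq_bigr => j _.
  have nE : n%:R = Num.sqrt n%:R ^+ 2 :> R by rewrite sqr_sqrtr ?ler0n.
  rewrite normrM normfV normrM (ger0_norm (sqrtr_ge0 _)) (gtr0_norm s0).
  by rewrite {2}nE; field; rewrite sn sq.
Qed.

(** Multiplying by the positive [Y] makes the event linear in [N] and [Y]. With r^2 = n and [A] the
    mean exposure, x r A is the mean of x Y / r; adding it to both sides centres the left one. *)
Lemma studentized_le (N Y theta r sigma A x : R) :
  0 < r -> 0 < sigma -> 0 < Y ->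
  ((N / Y - theta) * r <= x) =
  ((N - theta * Y - x * (Y - r ^+ 2 * A) / r) / (r * sigma) <= x * A / sigma).
Proof.
move=> r0 s0 Y0.
rewrite ler_pdivrMr ?mulr_gt0//.
have -> : x * A / sigma * (r * sigma) = x * A * r by field; rewrite gt_eqF.
have -> : (N / Y - theta) * r = (N - theta * Y) * r / Y by field; rewrite gt_eqF.
rewrite ler_pdivrMr// -subr_ge0 -[RHS]subr_ge0.
have -> : x * A * r - (N - theta * Y - x * (Y - r ^+ 2 * A) / r) =
  (x * Y - (N - theta * Y) * r) / r by field; rewrite gt_eqF.
by rewrite pmulr_lge0// invr_gt0.
Qed.

(** The tests can differ only at the constant sample [k0], of weight [p k0 ^+ n]. *)
Lemma sum_prob_test_close (K : finType) (p : K -> R) (n : nat) (k0 : K)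
    (t1 t2 : pred {ffun 'I_n -> K}) : (forall j, 0 <= p j) ->
  (forall k, k != [ffun=> k0] -> t1 k = t2 k) ->
  `|\sum_(k : {ffun 'I_n -> K}) (\prod_i p (k i)) * (t1 k)%:R -
    \sum_(k : {ffun 'I_n -> K}) (\prod_i p (k i)) * (t2 k)%:R| <= p k0 ^+ n.
Proof.
move=> p0 t12; rewrite -sumrB (bigD1 [ffun=> k0])//= [X in _ + X]big1 ?addr0; last first.
  by move=> k /t12 ->; rewrite subrr.
rewrite -mulrBr normrM.
have -> : \prod_(i < n) p ([ffun=> k0] i) = p k0 ^+ n.
  by under eq_bigr do rewrite ffunE; rewrite prodr_const card_ord.
rewrite ger0_norm ?exprn_ge0// ler_piMr ?exprn_ge0//.
by case: (t1 _); case: (t2 _); rewrite ?subrr ?subr0 ?sub0r ?normrN ?normr0 ?normr1.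
Qed.


Lemma cvg_EFin_near (f : nat -> \bar R) (g : nat -> R) (l : R) :
  (\forall n \near \oo, f n = (g n)%:E) -> g n @[n --> \oo] --> l ->
  f n @[n --> \oo] --> l%:E.
Proof.
move=> fg gl; apply/fine_cvgP; split.
  by apply: filterS fg => n ->.
apply: cvg_trans gl; apply: near_eq_cvg.
by apply: filterS fg => n /= ->.
Qed.

End estimator_limit.

Theorem corollary1 (R : realType) (G s : nat) (eps theta0 : R)
  (d : measure_display) (Omega : measurableType d) (P : probability Omega R)
  (X T : nat -> {RV P >-> nat})
  (d' : measure_display) (Omega' : measurableType d')
  (Q : probability Omega' R) (Z : {RV Q >-> R})
  (hG : (1 <= G)%N) (hs : (2 <= s)%N)
  (heps : 0 < eps < 2^-1) (htheta0 : eps <= theta0 <= 1 - eps)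
  (hiid : iid (fun i => pair_RV (X i) (T i)))
  (hX : forall i x : nat, (1 <= x)%N ->
    P [set w | X i w = x] = (theta0 * (1 - theta0) ^+ x.-1)%:E)
  (hT : forall (i : nat) (w : Omega), (T i w < G)%N)
  (hXT : forall i : nat, independent_RV2 (X i) (T i))
  (hZ : forall A : set R, measurable A ->
    distribution Q Z A = normal_prob 0 1 A) :
  cvg_in_distribution P Q
    (fun n => Num.sqrt n%:R \o* (theta_hat s G X T n \- cst theta0))
    ((PB_sigma s G theta0 X T)^-1 \o* Z).
Proof.
have th01 : 0 < theta0 < 1.
  by move: heps htheta0 => /andP[e0 e1] /andP[t0 t1]; apply/andP; split; lra.
have /andP[th0 th1] := th01.
have q0 : 0 < 1 - theta0 by rewrite subr_gt0.
pose p := age_prob (X 0%N) (T 0%N) (s := s).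
pose A := mean_exposure (X 0%N) (T 0%N) s.
have AE : A = _ := mean_exposureE th01 (hX 0%N) (hT 0%N) (hXT 0%N) s.
have A0 : 0 < A.
  rewrite AE mulr_gt0 ?(trunc_mass_gt0 th01 (hT 0%N) (hXT 0%N))//.
  rewrite (bigD1 (Ordinal (ltnW hs)))//= ltr_pwDl ?exprn_gt0//.
  by apply: sumr_ge0 => i _; rewrite exprn_ge0// ltW.
pose sigma := Num.sqrt (theta0 * (1 - theta0) * A).
have sigma2 : sigma ^+ 2 = theta0 * (1 - theta0) * A.
  by rewrite sqr_sqrtr// ltW// !mulr_gt0.
have sigma0 : 0 < sigma by rewrite sqrtr_gt0 !mulr_gt0.
(* [sigma] is the standard deviation of one score, and A / (theta0 (1 - theta0)) is the square of A
   / sigma. *)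
have PBE : PB_sigma s G theta0 X T = A / sigma.
  rewrite /PB_sigma (PB_sigma2E s th01 (hX 0%N) (hT 0%N) (hXT 0%N)) -/A.
  have -> : (theta0 * (1 - theta0))^-1 * A = (A / sigma) ^+ 2.
    by rewrite exprMn exprVn sigma2; field; rewrite !gt_eqF.
  by rewrite sqrtr_sqr ger0_norm// divr_ge0// ltW.
have PB0 : 0 < PB_sigma s G theta0 X T by rewrite PBE divr_gt0.
have p0 j : 0 <= p j by exact: age_prob_ge0.
have p1 : \sum_j p j = 1 by exact: sum_age_prob.
move=> x _.
have -> : cdf ((PB_sigma s G theta0 X T)^-1 \o* Z : {RV Q >-> R}) x =
    (normal_cdf (x * A / sigma))%:E.
  rewrite -normal_cdfE -hZ//; congr (Q _); apply/seteqP.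
  by split => w /=; rewrite !in_itv/= ler_pdivrMr// PBE mulrA.
pose D n (k : 'I_s.+2) : R :=
  score theta0 s k - x * (exposure R s k - A) / Num.sqrt n%:R.
pose u n k := D n k / (Num.sqrt n%:R * sigma).
(* [test] is the event on the estimator itself, including the value 0 of an empty ratio; [test'] is
   its linear form. [F] is exactly the distribution function to be studied, and the limit theorem
   applies to [F']. *)
pose test n (k : {ffun 'I_n -> 'I_s.+2}) :=
  ((\sum_(i < n) event_count R s (k i)) / (\sum_(i < n) exposure R s (k i))
     - theta0) * Num.sqrt n%:R <= x.
pose test' n (k : {ffun 'I_n -> 'I_s.+2}) :=
  \sum_(i < n) u n (k i) <= x * A / sigma.
pose F n := \sum_(k : {ffun 'I_n -> 'I_s.+2}) (\prod_i p (k i)) * (test n k)%:R.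
pose F' n := \sum_(k : {ffun 'I_n -> 'I_s.+2}) (\prod_i p (k i)) * (test' n k)%:R.
apply: (@cvg_EFin_near R _ F).
  apply: nearW => n.
  have := @prob_finite_test _ _ _ P _ p n
    (fun i => observed_age (X i) (T i) s) (test n)
    (fun i k => measurable_observed_age (X i) (T i) k)
    (fun k => prob_observed_ages k hiid).
  move=> <-; rewrite /cdf /distribution /pushforward; congr (P _).
  have testE w : test n [ffun i : 'I_n => observed_age (X i) (T i) s w] =
      ((theta_hat s G X T n w - theta0) * Num.sqrt n%:R <= x).
    rewrite /test theta_hatE//; congr ((_ / _ - _) * _ <= _);
      by apply: eq_bigr => i _; rewrite ffunE.
  by apply/seteqP; split => w /=; rewrite in_itv/= testE.
have F'cvg : F' n @[n --> \oo] --> normal_cdf (x * A / sigma).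
  have := @clt_sqrt_array R _ p D (fun k => score theta0 s k) sigma (x * A / sigma)
    sigma0 p0 p1.
  under [X in _ -> _ -> _ -> (X @ _ --> _)]eq_fun => n.
    rewrite /iid_mean.
    under eq_bigr => k _ do rewrite add0r.
    over.
  apply.
  - move=> n; rewrite /D.
    transitivity (\sum_k p k * score theta0 s k
        - x / Num.sqrt n%:R * (\sum_k p k * exposure R s k - (\sum_k p k) * A)).
      rewrite big_distrl -sumrB big_distrr -sumrB/=; apply: eq_bigr => k _; ring.
    rewrite (mean_score th01 (hX 0%N) (hT 0%N) (hXT 0%N)) p1.
    by rewrite mul1r subrr mulr0 subrr.
  - move=> k; rewrite -[X in _ --> X]subr0; apply: cvgB; first exact: cvg_cst.
    rewrite -[X in _ --> X](mulr0 (x * (exposure R s k - A))).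
    by apply: cvgMl_tmp; exact: cvg_invr_sqrt.
  - by rewrite (mean_score_sqr th01 (hX 0%N) (hT 0%N) (hXT 0%N)) sigma2.
(* The sample of only unobserved units has weight [p ord0 ^+ n], which tends to 0. *)
have FF' : F' n - F n @[n --> \oo] --> (0 : R).
  have pn : p ord0 ^+ n @[n --> \oo] --> (0 : R).
    apply: cvg_expr; rewrite ger0_norm//.
    exact: (age_prob0_lt1 th01 (hX 0%N) (hT 0%N) (hXT 0%N)).
  apply/norm_cvg0P.
  apply: (@squeeze_cvgr _ _ _ _ (cst 0) (fun n => p ord0 ^+ n)) => //;
    last exact: cvg_cst.
  near=> n; rewrite normr_ge0/=.
  (* The two tests can only disagree when no unit is observed. *)
  have n0 : (0 < n)%N by near: n; exists 1%N.
  rewrite distrC; apply: sum_prob_test_close => // k kn.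
  have [i ki] : exists i, k i != ord0.
    apply/existsP; rewrite -negb_forall; apply: contra kn => /forallP h.
    by apply/eqP/ffunP => i; rewrite ffunE; apply/eqP.
  have Y0 : 0 < \sum_(i < n) exposure R s (k i).
    rewrite (bigD1 i)//= ltr_pwDl//.
      by rewrite /exposure ltr0n leq_min (leq_trans _ hs)// lt0n andbT.
    exact: sumr_ge0.
  rewrite /test /test' (@studentized_le R _ _ _ _ sigma A)// ?sqrtr_gt0 ?ltr0n//.
  congr (_ <= _); rewrite /u -big_distrl/=; congr (_ / _).
  rewrite /D sumrB /score sumrB sqr_sqrtr ?ler0n//; congr (_ - _ - _).
    by rewrite big_distrr.
  rewrite -big_distrl/= -big_distrr/= sumrB sumr_const card_ord.
  by rewrite mulr_natl.
have -> : F = (fun n => F' n - (F' n - F n)).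
  by apply/funext => n; rewrite opprB addrC subrK.
by rewrite -[X in _ --> X]subr0; apply: cvgB.
Unshelve. all: by end_near.
Qed.
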